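(* There exist precisely four classes of toric blowups of $\mathbb{P}^3$ which have nontrivial toric symmetry, namely the classes A, B, C and D described in the context. Moreover, a space of Class A, B or D admits a unique nontrivial toric symmetry (up to relabeling), whereas there are precisely four distinct nontrivial toric symmetries for Class C varieties.
   Context: Work over $\mathbb{C}$. The fan of $\mathbb{P}^3$ in $\mathbb{Z}^3$ has rays generated by $v_1=(-1,-1,-1)$, $v_2=(1,0,0)$, $v_3=(0,1,0)$, $v_4=(0,0,1)$ and maximal cones $\langle v_i,v_j,v_k\rangle$ for $i<j<k$. The point $p_{ijk}$ is the orbit closure of $\langle v_i,v_j,v_k\rangle$ and the line $\ell_{ij}$ is the orbit closure of $\langle v_i,v_j\rangle$. Toric blowup: $X$ is a toric blowup of $\mathbb{P}^3$ if it is an iterated blowup of $\mathbb{P}^3$ only along torus-invariant subvarieties of $\mathbb{P}^3$ or their proper transforms (no centers in the exceptional locus). It is determined by a collection of torus-fixed points, blown up first, and an ordered collection of torus-invariant lines, blown up afterwards. Blowing up $p_{ijk}$ (resp. $\ell_{rs}$) subdivides the fan by inserting the ray $v_{ijk}=v_i+v_j+v_k$ (resp. $v_{rs}=v_r+v_s$). Toric symmetry: an automorphism of the lattice $\mathbb{Z}^3$ which permutes the cones of the fan $\Sigma_X$ of $X$. A toric symmetry is called nontrivial if it acts nontrivially on homology, in a manner meaningfully different from a simple relabeling of the cones; this is characterized as follows. The primitive ray generators of $\Sigma_X$ form three sets: $\{v_1,\dots,v_4\}$, the $v_{ijk}$ of the blown-up points, and the $v_{rs}$ of the blown-up lines; a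 toric symmetry is nontrivial if it does not map each of these three sets to itself. Classes (centers torus-invariant and blown up sequentially in the listed order, lines being replaced by proper transforms): - Class A: the blowup of $\mathbb{P}^3$ along a point $p$ and two intersecting distinct lines $\ell_1$ and $\ell_2$, such that $p\neq\ell_1\cap\ell_2$. - Class B: the sequential blowup of $\mathbb{P}^3$ at distinct points $p_1$ and $p_2$ and three pairwise intersecting lines $\ell_1,\ell_2,\ell_3$ such that $p_1\in\ell_1$, $p_2\in\ell_3$ and $p_1,p_2\notin\ell_2$. - Class C: the sequential blowup of $\mathbb{P}^3$ at distinct points $p_1$ and $p_2$ and three pairwise intersecting lines $\ell_1,\ell_2,\ell_3$ such that $p_1\in\ell_2$, $p_2\in\ell_3$ and $p_1,p_2\notin\ell_1$. - Class D: the sequential blowup of $\mathbb{P}^3$ at 4 distinct points $p_1,\dots,p_4$ and the six distinct lines $\ell_{ij}$ between them.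
   Formalization: As worded the claim fails; here Class A requires p to lie on neither line, and in Classes B and C the three lines form a chain with skew outer lines (middle line ℓ2 in B, ℓ1 in C, avoiding p1 and p2) instead of being pairwise intersecting. *)

(* Defs.v *)
From mathcomp Require Import all_boot all_order all_algebra.
From mathcomp Require Import finmap.

Set Implicit Arguments.
Unset Strict Implicit.
Unset Printing Implicit Defensive.

Import Order.TTheory GRing.Theory Num.Theory.
Local Open Scope ring_scope.
Local Open Scope fset_scope.

(* Row vectors: an automorphism g of Z^3 acts by w |-> w *m g. *)
Notation lattice := 'rV[int]_3.

(* The rays are indexed by 0, 1, 2, 3: v 0 = (-1,-1,-1) and v j.+1 = e_j. *)
Definition v (i : 'I_4) : lattice :=
  \row_(j < 3) (if i == ord0 then -1 else ((i : nat) == j.+1)%:R).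

Definition gens (I : {set 'I_4}) : {fset lattice} := [fset v i | i in I].

Definition ray (I : {set 'I_4}) : lattice := \sum_(i in I) v i.

(* All the fans below are simplicial.  A fan is the set of all its cones (not
   only the maximal ones), each given by the set of its primitive ray
   generators; in_cone is the corresponding cone in Z^3 (x) R. *)
Definition fan := {fset {fset lattice}}.

Definition in_cone (R : realFieldType) (s : {fset lattice}) (x : 'rV[R]_3) :
    Prop :=
  exists2 a : lattice -> R, (forall w, 0 <= a w)
    & x = \sum_(w <- s) a w *: map_mx intr w.

Definition P3_fan : fan := [fset gens I | I : {set 'I_4} & (#|I| <= 3)%N].

(* Star subdivision of F at the cone spanned by gens I, with new ray ray I.
   The subset I also denotes the orbit closure of that cone and the successive
   proper transforms of this orbit closure. *)
Definition blowup (F : fan) (I : {set 'I_4}) : fan :=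
  [fset s in F | ~~ (gens I `<=` s)] `|`
  [fset ray I |` s | s in F & ~~ (gens I `<=` s) && ((gens I `|` s) \in F)].

(* Orbit closures in P^3: the point p_ijk is {i,j,k}, the line l_ij is {i,j},
   so inclusion is reversed. *)
Definition is_point (p : {set 'I_4}) : bool := #|p| == 3.
Definition is_line (l : {set 'I_4}) : bool := #|l| == 2.
Definition on (p l : {set 'I_4}) : bool := l \subset p.

(* Two torus-invariant lines intersect iff they share a torus-fixed point. *)
Definition meet (l m : {set 'I_4}) : bool :=
  [exists p, [&& is_point p, on p l & on p m]].

Record toric_blowup := ToricBlowup {
  points : {set {set 'I_4}};
  lines : seq {set 'I_4};
  points_are_points : forall p, p \in points -> is_point p;
  lines_are_lines : forall l, l \in lines -> is_line l;
  lines_uniq : uniq lines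
}.

(* The points have pairwise disjoint stars in P3_fan, so the order of
   enum (points X) is irrelevant; the order of lines X matters. *)
Definition fan_of (X : toric_blowup) : fan :=
  foldl blowup (foldl blowup P3_fan (enum (points X))) (lines X).

Definition maps_cone_onto (R : realFieldType) (g : 'M[int]_3)
    (s t : {fset lattice}) : Prop :=
  forall x : 'rV[R]_3, in_cone s x <-> in_cone t (x *m map_mx intr g).

Definition toric_symmetry (R : realFieldType) (X : toric_blowup)
    (g : 'M[int]_3) : Prop :=
  [/\ g \in unitmx,
      forall s, s \in fan_of X ->
        exists2 t, t \in fan_of X & maps_cone_onto R g s t
    & forall t, t \in fan_of X ->
        exists2 s, s \in fan_of X & maps_cone_onto R g s t].

Definition coordinate_rays : {fset lattice} := [fset v i | i in 'I_4].
Definition point_rays (X : toric_blowup) : {fset lattice} :=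
  [fset ray p | p in points X].
Definition line_rays (X : toric_blowup) : {fset lattice} :=
  [fset ray l | l in lines X].

Definition preserves (g : 'M[int]_3) (A : {fset lattice}) : Prop :=
  [fset w *m g | w in A] = A.

Definition preserves_ray_types (X : toric_blowup) (g : 'M[int]_3) : Prop :=
  [/\ preserves g coordinate_rays, preserves g (point_rays X)
    & preserves g (line_rays X)].

Definition nontrivial_symmetry (R : realFieldType) (X : toric_blowup)
    (g : 'M[int]_3) : Prop :=
  toric_symmetry R X g /\ ~ preserves_ray_types X g.

Definition relabeling (R : realFieldType) (X : toric_blowup)
    (g : 'M[int]_3) : Prop :=
  toric_symmetry R X g /\ preserves_ray_types X g.

Definition unique_up_to_relabeling (R : realFieldType) (X : toric_blowup) :
    Prop :=
  exists2 g, nontrivial_symmetry R X g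
    & forall h, nontrivial_symmetry R X h ->
        exists2 r, relabeling R X r & h = g *m r.

Inductive blowup_class := ClassA | ClassB | ClassC | ClassD.

(* p lies on neither line: for p on exactly one of them the only toric symmetry
   is the identity. *)
Definition in_classA (X : toric_blowup) : Prop :=
  exists p l1 l2,
    [/\ points X = [set p]%SET, lines X = [:: l1; l2], meet l1 l2,
        ~~ on p l1 & ~~ on p l2].

(* In classes B and C the three lines form a chain whose middle line is the one
   avoiding p1 and p2 (blown up second in class B, first in class C), and the
   two outer lines are skew.  With three lines meeting two by two instead, the
   incidences with p1 and p2 force the lines to be concurrent, and all toric
   symmetries are then trivial. *)
Definition in_classB (X : toric_blowup) : Prop :=
  exists p1 p2 l1 l2 l3,
    [/\ p1 != p2, points X = [set p1; p2]%SET, lines X = [:: l1; l2; l3],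
        [/\ meet l1 l2, meet l2 l3 & ~~ meet l1 l3]
      & [/\ on p1 l1, on p2 l3, ~~ on p1 l2 & ~~ on p2 l2]].

Definition in_classC (X : toric_blowup) : Prop :=
  exists p1 p2 l1 l2 l3,
    [/\ p1 != p2, points X = [set p1; p2]%SET, lines X = [:: l1; l2; l3],
        [/\ meet l1 l2, meet l1 l3 & ~~ meet l2 l3]
      & [/\ on p1 l2, on p2 l3, ~~ on p1 l1 & ~~ on p2 l1]].

Definition in_classD (X : toric_blowup) : Prop :=
  (forall p, is_point p -> p \in points X) /\
  (forall l, is_line l -> l \in lines X).

Definition in_class (k : blowup_class) : toric_blowup -> Prop :=
  match k with
  | ClassA => in_classA
  | ClassB => in_classB
  | ClassC => in_classC
  | ClassD => in_classD
  end.

(* Main.v *)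
Require Import Defs.
From mathcomp Require Import all_boot all_order all_algebra.
From mathcomp Require Import finmap.
From mathcomp Require Import zify ring.

(* A toric symmetry of a fan whose cones are generated by parts of lattice bases
   permutes the generators, since the generators of such a cone are the
   indecomposable elements of its monoid of lattice points.  The rays that occur
   here are the 14 vectors v_I for I a nonempty proper subset of {0,1,2,3}, and
   the v_i sum to zero, so a symmetry sends (v_0,...,v_3) to a quadruple of these
   vectors with sum zero.  This leaves 336 candidate matrices, independently of
   the blowup.  A candidate can only be a symmetry if it permutes the rays, which
   depend on the set of lines but not on their order; few pairs of a set of
   points and a set of lines admit a nontrivial candidate of this kind, and for
   those all orders of the lines are tested on the maximal cones. *)

Set Implicit Arguments.
Unset Strict Implicit.
Unset Printing Implicit Defensive.

Import Order.TTheory GRing.Theory Num.Theory.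

(** The real field is eliminated through smoothness. Star subdivision exchanges one generator of a
    face for the sum of the generators of that face, a unimodular change, so every cone that occurs
    keeps a family of integral functionals dual to its generators. Such a cone meets the lattice
    exactly in the natural combinations of its generators, whatever [R] is. The size of the
    enumeration shapes the rest. There are 16 sets of points and 1957 ordered lists of distinct
    lines, so the search is run on natural numbers alone: subsets become codes, equalities of
    vectors become comparisons of bit counts, and matrices become tables. Class D accounts for 720
    orders of the six lines; they all give the same maximal cones, so the symmetries are computed
    for one order only. *)

Section Cones.
Local Open Scope fset_scope.
Local Open Scope ring_scope.

(** * Smooth cones and the recovery of their generators *)

Definition transport (g : 'M[int]_3) (s : {fset lattice}) : {fset lattice} :=
  [fset w *m g | w in s].

Lemma mulmx_unit_inj (g : 'M[int]_3) : g \in unitmx ->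
  injective (fun w : lattice => w *m g).
Proof. by move=> gU w u /(congr1 (mulmx^~ (invmx g))); rewrite !mulmxK. Qed.

Lemma transport_mem g s w : w \in s -> w *m g \in transport g s.
Proof. by move=> ws; apply/imfsetP; exists w. Qed.

Lemma mem_transport g s w : g \in unitmx -> (w *m g \in transport g s) = (w \in s).
Proof.
move=> gU; apply/imfsetP/idP => [[u /= us /(mulmx_unit_inj gU) -> //]|ws].
by exists w.
Qed.

Lemma transport_sub g s t : s `<=` t -> transport g s `<=` transport g t.
Proof.
move=> /fsubsetP st; apply/fsubsetP => _ /imfsetP[w /= ws ->].
by apply: transport_mem; apply: st.
Qed.

Lemma transport_inj g : g \in unitmx -> injective (transport g).
Proof.
move=> gU s t est; apply/fsetP => w.
by rewrite -(mem_transport s w gU) est mem_transport.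
Qed.

Lemma card_transport g s : g \in unitmx -> #|` transport g s| = #|` s|.
Proof. by move=> gU; rewrite card_imfset //; apply: mulmx_unit_inj. Qed.

Lemma transport_set1 g w : transport g [fset w] = [fset w *m g].
Proof.
apply/fsetP => x; apply/imfsetP/fset1P => [[_ /= /fset1P -> ->] //|->].
by exists w; rewrite ?inE.
Qed.

(** The [phi u] are integral coordinates with respect to [s]; their existence says that [s] is part
    of a basis of the lattice, that is, that the cone is smooth. *)
Definition dual_family (s : {fset lattice}) (phi : lattice -> 'cV[int]_3) : Prop :=
  {in s &, forall w u, (w *m phi u) 0 0 = (w == u)%:R}.

Definition has_dual (s : {fset lattice}) : Prop := exists phi, dual_family s phi.

(** [K] is arbitrary because the computation is read over [R] for real cones and over the integers
    for lattice points. *)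
Lemma dual_coord (K : comNzRingType) s phi (a : lattice -> K) u :
  dual_family s phi -> u \in s ->
  ((\sum_(w <- s) a w *: map_mx intr w) *m map_mx intr (phi u)) 0 0 = a u.
Proof.
move=> phiP us; rewrite mulmx_suml summxE (big_fsetD1 u) //= big_seq big1 => [|w].
  by rewrite addr0 -scalemxAl mxE -map_mxM mxE phiP // eqxx mulr1.
rewrite !inE => /andP[/negPf wu ws].
by rewrite -scalemxAl mxE -map_mxM mxE phiP // wu mulr0.
Qed.

Definition lattice_point (s : {fset lattice}) (x : lattice) : Prop :=
  exists n : lattice -> nat, x = \sum_(w <- s) w *+ n w.

Lemma lattice_coord s phi (n : lattice -> nat) u : dual_family s phi -> u \in s ->
  ((\sum_(w <- s) w *+ n w) *m phi u) 0 0 = (n u)%:R.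
Proof.
move=> phiP us; rewrite -(dual_coord (fun w => (n w)%:R : int) phiP us).
have mapid m p (A : 'M[int]_(m, p)) : map_mx intr A = A.
  by apply/matrixP => i j; rewrite mxE intz.
by rewrite mapid; under [in RHS]eq_bigr do rewrite mapid scaler_nat.
Qed.

(** Pairing a lattice point with the dual functionals shows that its real coefficients are integers;
    being nonnegative, they are unchanged by [absz]. *)
Lemma in_coneE (R : realFieldType) s x : has_dual s ->
  in_cone s (map_mx intr x : 'rV[R]_3) <-> lattice_point s x.
Proof.
case=> phi phiP; split=> [[a a0 xE]|[n ->]]; last first.
  exists (fun w => (n w)%:R) => [w|]; first exact: ler0n.
  by rewrite raddf_sum /=; apply: eq_bigr => w _; rewrite raddfMn scaler_nat.
exists (fun w => absz ((x *m phi w) 0 0)).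
have aE w : w \in s -> a w = (absz ((x *m phi w) 0 0))%:R.
  move=> ws; have := dual_coord a phiP ws; rewrite -xE -map_mxM mxE => awE.
  have : 0 <= (x *m phi w) 0 0 by rewrite -(ler0z R) awE.
  by rewrite -awE; case: ((x *m phi w) 0 0) => // k _; rewrite natrz.
have inj : injective (map_mx intr : lattice -> 'rV[R]_3).
  move=> y z /matrixP e; apply/matrixP => i j; apply: (intr_inj (R:=R)).
  by have := e i j; rewrite !mxE.
apply: inj; rewrite xE raddf_sum big_seq [RHS]big_seq /=.
by apply: eq_bigr => w ws; rewrite aE // raddfMn scaler_nat.
Qed.

(** The atoms of the monoid of lattice points of a pointed cone are its Hilbert basis. *)
Definition atom (A : lattice -> Prop) (w : lattice) : Prop :=
  [/\ A w, w <> 0 & forall x y, A x -> A y -> w = x + y -> x = 0 \/ y = 0].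

Lemma lattice_point_gen s w : w \in s -> lattice_point s w.
Proof.
move=> ws; exists (fun u => (u == w) : nat).
rewrite (big_fsetD1 w) //= eqxx mulr1n big_seq big1 ?addr0 // => u.
by rewrite !inE => /andP[/negPf ->]; rewrite mulr0n.
Qed.

(** Coordinates add up. Those of a generator are 0 except for a single 1, so one of two summands has
    all its coordinates zero. Conversely, a nonzero element has a positive coefficient at some [u]
    and splits off [u], so an atom must equal [u]. *)
Lemma atom_gens s w : has_dual s -> w \in s <-> atom (lattice_point s) w.
Proof.
case=> phi phiP.
have nz u : u \in s -> u <> 0.
  move=> us u0; have := phiP u u us us.
  by rewrite eqxx {1}u0 mul0mx mxE => /eqP; rewrite eq_sym oner_eq0.
have zero n : (forall u, u \in s -> n u = 0%N) -> \sum_(u <- s) u *+ n u = 0 :> lattice.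
  by move=> n0; rewrite big_seq big1 // => u us; rewrite n0.
split=> [ws|[[n wE] w0 wI]].
  split; [exact: lattice_point_gen|exact: nz|].
  move=> x y [n xE] [m yE] wE.
  have nm u : u \in s -> (n u + m u)%N = (w == u).
    move=> us; apply/eqP; rewrite -(eqr_nat int) natrD.
    by rewrite -(lattice_coord n phiP us) -(lattice_coord m phiP us) -xE -yE
         -phiP // wE mulmxDl [X in _ == X]mxE.
  case: (posnP (n w)) => [nw|nw]; [left; rewrite xE|right; rewrite yE]; apply: zero => u us;
    have := nm u us; have := nm w ws; case: (w =P u) => [<-|_]; rewrite ?eqxx; lia.
have [u us un] : exists2 u, u \in s & (0 < n u)%N.
  have [/hasP[u us un]|/hasPn n0] := boolP (has (fun u => 0 < n u)%N s); first by exists u.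
  by case: w0; rewrite wE; apply: zero => u /n0; rewrite -eqn0Ngt => /eqP.
(* One copy of [u] is removed; the subtraction does not truncate, as [n u] is positive. *)
pose m v := (n v - (v == u))%N.
have wum : w = u + \sum_(v <- s) v *+ m v.
  rewrite wE (big_fsetD1 u) //= [in RHS](big_fsetD1 u) //= addrA /m eqxx.
  rewrite -mulrS subn1 prednK //; congr (_ + _).
  rewrite big_seq [RHS]big_seq; apply: eq_bigr => v; rewrite !inE => /andP[/negPf ->].
  by rewrite subn0.
have [||/(nz _ us)//|m0] := wI _ _ _ _ wum; first exact: lattice_point_gen.
- by exists m.
- by rewrite wum m0 addr0.
Qed.

(** Atoms are defined by addition and zero alone, so an invertible [g] matches the atoms of the two
    monoids. *)
Lemma maps_cone_onto_transport (R : realFieldType) g s t : g \in unitmx ->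
  has_dual s -> has_dual t -> maps_cone_onto R g s t -> t = transport g s.
Proof.
move=> gU sD tD st.
have pt x : lattice_point s x <-> lattice_point t (x *m g).
  by rewrite -(in_coneE R x sD) -(in_coneE R _ tD) map_mxM; apply: st.
have at_ w : w \in s <-> w *m g \in t.
  rewrite (atom_gens _ sD) (atom_gens _ tD); split=> -[sw w0 wI].
    split; [exact/pt|by move=> /(congr1 (mulmx^~ (invmx g))); rewrite mulmxK // mul0mx|].
    move=> x y; rewrite -[x](mulmxKV gU) -[y](mulmxKV gU) => /pt xs /pt ys.
    rewrite -mulmxDl => /(mulmx_unit_inj gU) /(wI _ _ xs ys).
    by case=> ->; rewrite mul0mx; [left|right].
  split; [exact/pt|by move=> e; apply: w0; rewrite e mul0mx|].
  move=> x y /pt xs /pt ys wE; rewrite wE mulmxDl in wI.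
  by case: (wI _ _ xs ys erefl) => e; [left|right];
    apply: (mulmx_unit_inj gU); rewrite e mul0mx.
apply/fsetP => u; rewrite -[u](mulmxKV gU) mem_transport //.
by apply/idP/idP => /at_.
Qed.

Lemma maps_cone_onto_self (R : realFieldType) g s : g \in unitmx ->
  maps_cone_onto R g s (transport g s).
Proof.
move=> gU x.
have sumE (a : lattice -> R) : \sum_(w <- transport g s) a w *: map_mx intr w =
    (\sum_(w <- s) a (w *m g) *: map_mx intr w) *m map_mx intr g.
  rewrite big_imfset /=; last by move=> ? ? _ _; apply: mulmx_unit_inj.
  by rewrite mulmx_suml; apply: eq_bigr => w _; rewrite map_mxM scalemxAl.
split=> -[a a0 xE].
  exists (fun w => a (w *m invmx g)) => [w //|].
  by rewrite sumE xE; under [in RHS]eq_bigr do rewrite mulmxK //.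
exists (fun w => a (w *m g)) => [w //|].
have gRU : map_mx intr g \in (unitmx : pred 'M[R]_3).
  by rewrite unitmxE det_map_mx rmorph_unit.
by move/(congr1 (mulmx^~ (invmx (map_mx intr g)))): xE; rewrite sumE !mulmxK.
Qed.

End Cones.

(** * Smoothness of the iterated blowups, and symmetries as permutations of cones *)

Section Fans.
Local Open Scope fset_scope.
Local Open Scope ring_scope.

(* The functional on Z^4 / (1,1,1,1) that is the difference of coordinates i and k. *)
Definition coord_form (k i : 'I_4) : 'cV[int]_3 :=
  \col_(m < 3) ((i == lift ord0 m)%:R - (k == lift ord0 m)%:R).

Lemma coord_formP (k i j : 'I_4) :
  (v j *m coord_form k i) 0 0 = (j == i)%:R - (j == k)%:R.
Proof.
rewrite !mxE !big_ord_recl big_ord0 !mxE.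
by case: k i j => [[|[|[|[|?]]]] ?] // [[|[|[|[|?]]]] ?] // [[|[|[|[|?]]]] ?].
Qed.

Lemma v_inj : injective v.
Proof.
move=> i j vij; apply/eqP.
(* Relative to a third index [k], the form [coord_form k i] is 1 on [v i] and vanishes on [v j] as
   soon as [j] differs from [i]. *)
have [k /andP[ki kj]] : exists k : 'I_4, (k != i) && (k != j).
  case: i j {vij} => [[|[|[|[|?]]]] ?] // [[|[|[|[|?]]]] ?] //;
  by [exists ord0|exists (lift ord0 ord0)|exists ord_max
     |exists (inord 2); rewrite -!val_eqE /= inordK].
have := coord_formP k i i; rewrite {1}vij coord_formP eqxx.
rewrite [j == k]eq_sym [i == k]eq_sym (negPf ki) (negPf kj) eq_sym.
by case: (i == j).
Qed.

Lemma gens_sub (I : {set 'I_4}) (s : {fset lattice}) :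
  reflect (forall i, i \in I -> v i \in s) (gens I `<=` s).
Proof.
apply: (iffP (@fsubsetP _ (gens I) s)) => [Is i iI|Is _ /imfsetP[i /= iI ->]]; last exact: Is.
by apply: Is; apply/imfsetP; exists i.
Qed.

Lemma mem_gens (I : {set 'I_4}) i : (v i \in gens I) = (i \in I).
Proof.
apply/imfsetP/idP => [[j /= jI /v_inj -> //]|iI].
by exists i.
Qed.

Lemma has_dual_sub s t : s `<=` t -> has_dual t -> has_dual s.
Proof.
by move=> /fsubsetP st [phi phiP]; exists phi => w u ws us; apply: phiP; apply: st.
Qed.

(** Some index [k] lies outside [I], and the coordinates taken relative to the [k]-th one are dual
    to the vectors [v i] with [i] in [I]. *)
Lemma has_dual_gens (I : {set 'I_4}) : (#|I| <= 3)%N -> has_dual (gens I).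
Proof.
move=> I3.
have [k kI] : exists k, k \notin I.
  apply/existsP; rewrite -negb_forall; apply: contraL I3 => /forallP IT.
  by rewrite (_ : I = setT) ?cardsT ?card_ord //; apply/setP => i; rewrite inE IT.
exists (fun w => coord_form k (odflt k [pick i | v i == w])).
move=> _ _ /imfsetP[i /= iI ->] /imfsetP[j /= jI ->].
rewrite coord_formP; case: pickP => [l /eqP/v_inj ->|/(_ j)]; last by rewrite eqxx.
have -> : (i == k) = false by apply: contraNF kI => /eqP <-.
by rewrite subr0 (inj_eq v_inj).
Qed.

(** [v i] occurs in [ray I] with coefficient 1. Hence the functional of [v i] serves for [ray I],
    and subtracting a multiple of it from each other functional makes that one vanish on [ray I]. *)
Lemma has_dual_star (I : {set 'I_4}) i t : i \in I -> gens I `<=` t ->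
  has_dual t -> has_dual (ray I |` (t `\ v i)).
Proof.
move=> iI /gens_sub It [phi phiP].
have rayP : (ray I *m phi (v i)) 0 0 = 1.
  rewrite mulmx_suml summxE (bigD1 i) //= phiP ?It // eqxx big1 ?addr0 // => j.
  by move=> /andP[jI ji]; rewrite phiP ?It // (inj_eq v_inj) (negPf ji).
exists (fun w => if w == ray I then phi (v i)
  else phi w - (ray I *m phi w) 0 0 *: phi (v i)).
(* The new ray differs from the generators that remain, so the case distinction on [w == ray I] is
   sound. *)
have rayN u : u \in t -> u != v i -> u == ray I = false.
  move=> ut ui; apply: contraNF ui => /eqP ur.
  by have := phiP u (v i) ut (It i iI); rewrite ur rayP; case: eqP.
have subE (A B : 'M[int]_1) c : (A - c *: B) 0 0 = A 0 0 - c * B 0 0 by rewrite !mxE.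
move=> w u; rewrite !inE => /orP[/eqP ->|/andP[wi wt]] /orP[/eqP ->|/andP[ui ut]].
- by rewrite !eqxx.
- rewrite [ray I == u]eq_sym rayN // mulmxBr -scalemxAr subE.
  by rewrite rayP mulr1 subrr.
- by rewrite eqxx phiP ?It // (negPf wi) rayN.
- have wP := phiP w (v i) wt (It i iI); rewrite (negPf wi) in wP.
  rewrite rayN // mulmxBr -scalemxAr subE (phiP w u) //.
  by rewrite wP mulr0 subr0.
Qed.

Lemma in_blowup (F : fan) (I : {set 'I_4}) (s : {fset lattice}) :
  s \in blowup F I <-> (s \in F /\ ~~ (gens I `<=` s)) \/
    exists t, [/\ t \in F, ~~ (gens I `<=` t), gens I `|` t \in F & s = ray I |` t].
Proof.
rewrite /blowup inE; split=> [/orP[]|].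
- by rewrite !inE /= => /andP[]; left.
- by case/imfsetP => t /=; rewrite !inE => /and3P[? ? ?] ->; right; exists t.
- case=> [[sF sI]|[t [tF tI ItF ->]]]; apply/orP; [left|right].
    by rewrite !inE sF.
  by apply/imfsetP; exists t => //=; rewrite !inE tF tI.
Qed.

(** A cone [t] that does not contain the center misses some [v i] of it, so the new cone over [t] is
    part of the smooth cone spanned by [t] and the center with [v i] exchanged for the new ray. *)
Lemma blowup_dual (F : fan) I : (forall s, s \in F -> has_dual s) ->
  forall s, s \in blowup F I -> has_dual s.
Proof.
move=> dF s /in_blowup [[sF _]|[t [tF tI ItF ->]]]; first exact: dF.
have [i /andP[iI it]] : exists i, (i \in I) && (v i \notin t).
  apply/existsP; apply: contraR tI; rewrite negb_exists => /forallP It.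
  by apply/gens_sub => i iI; have := It i; rewrite iI negbK.
apply: has_dual_sub (has_dual_star iI (fsubsetUl _ t) (dF _ ItF)).
apply: fsetUS; apply/fsubsetP => w wt; rewrite !inE wt orbT andbT.
by apply: contraNneq it => <-.
Qed.

Lemma fan_of_ind (T : fan -> Prop) X : T P3_fan ->
  (forall F I, I \in points X \/ I \in lines X -> T F -> T (blowup F I)) ->
  T (fan_of X).
Proof.
move=> T0 TS; rewrite /fan_of.
have foldl_ind s F : (forall I, I \in s -> I \in points X \/ I \in lines X) ->
    T F -> T (foldl blowup F s).
  elim: s F => //= I s IH F sX TF; apply: IH => [J Js|].
    by apply: sX; rewrite inE Js orbT.
  by apply: TS => //; apply: sX; rewrite inE eqxx.
apply: (foldl_ind _ _) => [I Il|]; first by right.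
by apply: (foldl_ind _ _) => // I; rewrite mem_enum => Ip; left.
Qed.

Lemma P3_fanP s : reflect (exists2 I : {set 'I_4}, (#|I| <= 3)%N & s = gens I) (s \in P3_fan).
Proof.
apply: (iffP idP) => [/imfsetP[I /= I3 ->]|[I I3 ->]]; first by exists I; rewrite inE in I3.
by apply/imfsetP; exists I; rewrite //= inE.
Qed.

Lemma fan_of_dual X s : s \in fan_of X -> has_dual s.
Proof.
move: s; apply: (fan_of_ind (T := fun F => forall s, s \in F -> has_dual s)).
  by move=> _ /P3_fanP[I I3 ->]; apply: has_dual_gens.
by move=> F I _; apply: blowup_dual.
Qed.

(** The fan is finite and [transport g] is injective, so mapping the fan into itself already means
    mapping it onto itself. *)
Lemma toric_symmetryE (R : realFieldType) X g : toric_symmetry R X g <->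
  g \in unitmx /\ forall s, s \in fan_of X -> transport g s \in fan_of X.
Proof.
split=> [[gU gF _]|[gU gF]].
  split=> // s sF; have [t tF st] := gF s sF.
  by rewrite -(maps_cone_onto_transport gU (fan_of_dual sF) (fan_of_dual tF) st).
split=> // [s sF|t].
- by exists (transport g s); [exact: gF|exact: maps_cone_onto_self].
- have sub : [fset transport g s | s in fan_of X] `<=` fan_of X.
    by apply/fsubsetP => _ /imfsetP[s /= sF ->]; apply: gF.
  have card : #|` [fset transport g s | s in fan_of X]| = #|` fan_of X|.
    by rewrite card_imfset //; apply: transport_inj.
  have /eqP FE : [fset transport g s | s in fan_of X] == fan_of X.
    by rewrite eqEfcard sub card leqnn.
  rewrite -{1}FE => /imfsetP[s /= sF ->]; exists s => //; exact: maps_cone_onto_self.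
Qed.

Lemma gens_fan_of X (J : {set 'I_4}) : (#|J| <= 3)%N ->
  (forall I, I \in points X \/ I \in lines X -> ~~ (I \subset J)) -> gens J \in fan_of X.
Proof.
move=> J3 nJ; apply: (fan_of_ind (T := fun F => gens J \in F)) => [|F I IX JF].
  by apply/P3_fanP; exists J.
apply/in_blowup; left; split=> //; apply: contra (nJ I IX) => /gens_sub IJ.
by apply/subsetP => i /IJ; rewrite mem_gens.
Qed.

End Fans.

(** * Numerical codes for rays, cones and star subdivisions *)

(* A subset I of {0,1,2,3} is coded by the number whose binary digits it lists,
   so the nonempty proper subsets have the codes 1, ..., 14.  A cone is coded by
   the list of the codes of its generators, a fan by its maximal cones. *)
Definition bit (n i : nat) : bool := odd (iter i half n).
Definition subseteq (s t : seq nat) : bool := all (fun k => k \in t) s.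
Definition singles : seq nat := [:: 1; 2; 4; 8].
Definition point_codes : seq nat := [:: 7; 11; 13; 14].
Definition line_codes : seq nat := [:: 3; 5; 6; 9; 10; 12].
Definition codes : seq nat := iota 1 14.
Definition vertices (n : nat) : seq nat := [seq 2 ^ i | i <- iota 0 4 & bit n i].

(* The j-th coordinate of v_I is [j+1 in I] - [0 in I]; [same_sum] compares the
   coordinates of two sums of such vectors without subtraction. *)
Definition count_bit (s : seq nat) (i : nat) : nat :=
  sumn [seq nat_of_bool (bit n i) | n <- s].
Definition same_sum (s t : seq nat) : bool :=
  all (fun j => count_bit s j + count_bit t 0 == count_bit t j + count_bit s 0)
    [:: 1; 2; 3].

(** The new generator is put at the head of each new cone, where [block] looks for it. *)
Definition blow (M : seq (seq nat)) (n : nat) : seq (seq nat) :=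
  [seq m <- M | ~~ subseteq (vertices n) m] ++
  flatten [seq [seq n :: [seq k <- m | k != i] | i <- vertices n]
          | m <- M & subseteq (vertices n) m].
Definition P3_max : seq (seq nat) :=
  [:: [:: 2; 4; 8]; [:: 1; 4; 8]; [:: 1; 2; 8]; [:: 1; 2; 4]].
Definition max_cones (P L : seq nat) : seq (seq nat) :=
  foldl blow (foldl blow P3_max P) L.
Definition refines (M N : seq (seq nat)) : bool :=
  all (fun m => has (subseteq m) N) M.
Fixpoint sublists (s : seq nat) : seq (seq nat) :=
  if s is x :: s' then sublists s' ++ [seq x :: t | t <- sublists s'] else [:: [::]].

Definition decode (n : nat) : {set 'I_4} := [set i : 'I_4 | bit n i].
Definition encode (I : {set 'I_4}) : nat := 
  (inord 0 \in I) + (inord 1 \in I).*2 + (inord 2 \in I) * 4 + (inord 3 \in I) * 8.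
Definition code_ray (n : nat) : lattice := ray (decode n).

Section Codes.
Local Open Scope fset_scope.

Lemma decodeK n : n < 16 -> encode (decode n) = n.
Proof.
rewrite /encode !inE !inordK //.
by do 16 (case: n => [//|n]).
Qed.

Lemma encode_lt I : encode I < 16.
Proof. by rewrite /encode; do 4 case: (_ \in I). Qed.

Lemma encodeK I : decode (encode I) = I.
Proof.
apply/setP => i; rewrite inE /encode.
have -> : (i \in I) = (nth false [seq inord k \in I | k <- iota 0 4] i).
  by rewrite (nth_map 0) ?size_iota // nth_iota // add0n inord_val.
rewrite /=; case: i => [[|[|[|[|?]]]] ?] //=; by do 4 case: (_ \in I).
Qed.

Lemma card_decode n : #|decode n| = size (vertices n).
Proof.
rewrite size_map size_filter -sum1_card (eq_bigl (fun i : 'I_4 => bit n i)).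
  by rewrite -(big_mkord (bit n) (fun=> 1)) sum1_count.
by move=> i; rewrite inE.
Qed.

Lemma mem_point_codes I : is_point I = (encode I \in point_codes).
Proof.
rewrite /is_point -{1}[I]encodeK card_decode; move: (encode I) (encode_lt I).
by move=> n; do 16 (case: n => [//|n]).
Qed.

Lemma mem_line_codes I : is_line I = (encode I \in line_codes).
Proof.
rewrite /is_line -{1}[I]encodeK card_decode; move: (encode I) (encode_lt I).
by move=> n; do 16 (case: n => [//|n]).
Qed.

Lemma decode_pow2 (i : 'I_4) : decode (2 ^ i) = [set i]%SET.
Proof.
by apply/setP => j; rewrite !inE; case: i j => [[|[|[|[|?]]]] ?] // [[|[|[|[|?]]]] ?].
Qed.

Lemma code_ray_pow2 (i : 'I_4) : code_ray (2 ^ i) = v i.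
Proof. by rewrite /code_ray decode_pow2 /ray big_set1. Qed.

Lemma mem_vertices n k :
  reflect (exists2 i : 'I_4, i \in decode n & k = 2 ^ i) (k \in vertices n).
Proof.
apply: (iffP mapP) => [[i]|[i]]; last first.
  by rewrite inE => ni ->; exists (i : nat); rewrite // mem_filter ni mem_iota /=.
rewrite mem_filter mem_iota => /andP[ni /= i4] ->.
by exists (Ordinal i4); rewrite ?inE.
Qed.

Lemma singlesP k : reflect (exists i : 'I_4, k = 2 ^ i) (k \in singles).
Proof.
apply: (iffP idP) => [|[[[|[|[|[|?]]]] ?] ->] //].
by rewrite !inE => /or4P[] /eqP ->;
  [exists (inord 0)|exists (inord 1)|exists (inord 2)|exists (inord 3)]; rewrite inordK.
Qed.

Section Sums.
Local Open Scope ring_scope.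

Lemma code_rayE n (j : 'I_3) :
  code_ray n 0 j = (bit n j.+1)%:R - (bit n 0)%:R.
Proof.
rewrite /code_ray /ray summxE big_mkcond !big_ord_recl big_ord0 !inE /=.
rewrite /v !mxE; case: j => [[|[|[|?]]] ?] //=;
  by case: (bit n 0); case: (bit n 1); case: (bit n 2); case: (bit n 3).
Qed.

Lemma sum_code_rayE (s : seq nat) (j : 'I_3) :
  (\sum_(n <- s) code_ray n) 0 j = (count_bit s j.+1)%:R - (count_bit s 0)%:R.
Proof.
elim: s => [|n s IH]; first by rewrite big_nil mxE subrr.
by rewrite big_cons mxE IH code_rayE /count_bit /= !natrD; ring.
Qed.

Lemma same_sumP s t :
  reflect (\sum_(n <- s) code_ray n = \sum_(n <- t) code_ray n) (same_sum s t).
Proof.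
have eqE (j : 'I_3) : ((\sum_(n <- s) code_ray n) 0 j == (\sum_(n <- t) code_ray n) 0 j)
    = (count_bit s j.+1 + count_bit t 0 == count_bit t j.+1 + count_bit s 0)%N.
  rewrite !sum_code_rayE -(eqr_nat int) !natrD -subr_eq0 -[RHS]subr_eq0.
  by congr (_ == _); ring.
apply: (iffP allP) => [st|/matrixP st k].
  apply/rowP => j; apply/eqP; rewrite eqE; apply: st.
  by case: j => [[|[|[|?]]] ?].
have {}st (j : 'I_3) : (count_bit s j.+1 + count_bit t 0 == count_bit t j.+1 + count_bit s 0)%N.
  by rewrite -eqE st.
rewrite !inE => /or3P[]/eqP->.
- by have := st (inord 0); rewrite inordK.
- by have := st (inord 1); rewrite inordK.
- by have := st (inord 2); rewrite inordK.
Qed.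

End Sums.

(** The restriction to [codes] matters: 0 and 15, the empty and the full subset, both give the zero
    vector. *)
Lemma code_ray_inj : {in codes &, injective code_ray}.
Proof.
move=> n m nC mC nm.
have /same_sumP : (\sum_(k <- [:: n]) code_ray k = \sum_(k <- [:: m]) code_ray k)%R.
  by rewrite !big_seq1.
have /allP/(_ _ nC)/allP/(_ _ mC)/implyP :
    all (fun n => all (fun m => same_sum [:: n] [:: m] ==> (n == m)) codes) codes.
  by vm_compute.
by move=> H /H /eqP.
Qed.

Definition cone (m : seq nat) : {fset lattice} := [fset w in map code_ray m].

Lemma coneP m w : reflect (exists2 n, n \in m & w = code_ray n) (w \in cone m).
Proof. by rewrite inE; apply: mapP. Qed.

Lemma mem_cone m n : subseteq m codes -> n \in codes -> (code_ray n \in cone m) = (n \in m).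
Proof.
move=> /allP mC nC; apply/coneP/idP => [[k km /code_ray_inj -> //]|nm]; first exact: mC.
by exists n.
Qed.

Lemma cone_sub m m' : subseteq m m' -> cone m `<=` cone m'.
Proof. by move=> /allP mm; apply/fsubsetP => _ /coneP[n /mm nm ->]; apply/coneP; exists n. Qed.

Lemma vertices_codes n : subseteq (vertices n) codes.
Proof. by apply/allP => _ /mem_vertices[[[|[|[|[|?]]]] ?] _ ->]. Qed.

Lemma gens_decode n : gens (decode n) = cone (vertices n).
Proof.
apply/fsetP => w; apply/imfsetP/coneP => [[i /= ni ->]|[_ /mem_vertices[i ni ->] ->]].
  by exists (2 ^ i); [apply/mem_vertices; exists i|rewrite code_ray_pow2].
by exists i => //; rewrite code_ray_pow2.
Qed.

Lemma gens_sub_cone n m : subseteq m codes ->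
  (gens (decode n) `<=` cone m) = subseteq (vertices n) m.
Proof.
move=> mC; rewrite gens_decode; apply/fsubsetP/idP => [nm|/cone_sub/fsubsetP //].
apply/allP => k kn; rewrite -(mem_cone mC) ?(allP (vertices_codes n)) //.
by apply: nm; apply/coneP; exists k.
Qed.

Lemma cone_filter m k : subseteq m codes -> k \in codes ->
  cone [seq l <- m | l != k] = cone m `\ code_ray k.
Proof.
move=> mC kC; apply/fsetP => w; rewrite in_fsetD1; apply/coneP/andP.
  case=> n; rewrite mem_filter => /andP[nk nm] ->; split; last by apply/coneP; exists n.
  by apply: contraNneq nk => /code_ray_inj -> //; apply: (allP mC).
case=> wk /coneP[n nm wn]; exists n => //; rewrite mem_filter nm andbT.
by apply: contraNneq wk => <-; rewrite wn.
Qed.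

Definition valid (M : seq (seq nat)) : bool := all (fun m => subseteq m codes) M.

(** In a simplicial fan the faces of a cone are the subsets of its generators, so the maximal cones
    determine everything. *)
Definition spans (M : seq (seq nat)) (F : fan) : Prop :=
  forall s, s \in F <-> exists2 m, m \in M & s `<=` cone m.

Lemma mem_blow M n m : m \in blow M n <->
  (m \in M /\ ~~ subseteq (vertices n) m) \/
  exists m' i, [/\ m' \in M, subseteq (vertices n) m', i \in vertices n
    & m = n :: [seq k <- m' | k != i]].
Proof.
rewrite /blow mem_cat mem_filter; split=> [/orP[/andP[]|/flatten_mapP[m']]|].
- by left.
- rewrite mem_filter => /andP[nm' m'M] /mapP[i iI ->].
  by right; exists m', i.
- case=> [[-> ->] //|[m' [i [m'M nm' iI ->]]]]; apply/orP; right.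
  by apply/flatten_mapP; exists m'; [rewrite mem_filter nm'|apply/mapP; exists i].
Qed.

(** [C] is free because the bound is applied both to all codes and to the rays of one given
    blowup. *)
Lemma blow_codes (C : seq nat) M n : n \in C -> all (fun m => subseteq m C) M ->
  all (fun m => subseteq m C) (blow M n).
Proof.
move=> nC /allP MC; apply/allP => m /mem_blow [[/MC //]|[m' [i [/MC/allP m'C _ _ ->]]]].
by apply/allP => k; rewrite inE mem_filter => /orP[/eqP -> //|/andP[_ /m'C]].
Qed.

(** A cone not containing the center misses one of its vertices [i]; inside a maximal cone [m]
    containing the center it therefore survives in the piece of [m] where [i] is exchanged for the
    new ray. *)
Lemma blow_spans M F n : n \in codes -> valid M -> spans M F ->
  spans (blow M n) (blowup F (decode n)).
Proof.
move=> nC /allP vM MF s; pose r := ray (decode n).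
have vC i : i \in vertices n -> i \in codes := allP (vertices_codes n) i.
have missing t : ~~ (gens (decode n) `<=` t) ->
    exists2 i, i \in vertices n & code_ray i \notin t.
  rewrite gens_decode => /fsubsetPn[w /coneP[i ni ->] it]; by exists i.
have down s1 s2 : s1 `<=` s2 -> s2 \in F -> s1 \in F.
  by move=> s12 /MF[m mM s2m]; apply/MF; exists m => //; apply: fsubset_trans s2m.
have cone_new m : cone (n :: m) = r |` cone m.
  apply/fsetP => w; rewrite in_fset1U; apply/coneP/orP.
    case=> k; rewrite inE => /orP[/eqP-> ->|km ->]; [by left; rewrite eqxx|right].
    by apply/coneP; exists k.
  case=> [/eqP ->|/coneP[k km ->]]; first by exists n; rewrite ?mem_head.
  by exists k; rewrite // inE km orbT.
split.
  case/in_blowup => [[/MF[m mM sm] ns]|[t [/MF _ nt ntF ->]]].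
    case: (boolP (subseteq (vertices n) m)) => nm; last first.
      by exists m => //; apply/mem_blow; left.
    have [i iI is_] := missing _ ns.
    exists (n :: [seq k <- m | k != i]); first by apply/mem_blow; right; exists m, i.
    rewrite cone_new cone_filter ?vM ?vC //; apply/fsubsetP => w ws.
    rewrite in_fset1U in_fsetD1 (fsubsetP sm) // andbT; apply/orP; right.
    by apply: contraNneq is_ => <-.
  have /MF[m mM ntm] := ntF.
  have [i iI it] := missing _ nt.
  exists (n :: [seq k <- m | k != i]).
    apply/mem_blow; right; exists m, i; split=> //.
    by rewrite -gens_sub_cone ?vM //; apply: fsubset_trans ntm; apply: fsubsetUl.
  rewrite cone_new cone_filter ?vM ?vC //; apply: fsetUS; apply/fsubsetP => w wt.
  rewrite in_fsetD1 (fsubsetP ntm) ?inE ?wt ?orbT // andbT.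
  by apply: contraNneq it => <-.
case=> m /mem_blow [[mM nm] sm|[m' [i [m'M nm' iI ->]]]].
  apply/in_blowup; left; split; first by apply/MF; exists m.
  by apply: contra nm => ns; rewrite -gens_sub_cone ?vM //; apply: fsubset_trans sm.
rewrite cone_new cone_filter ?vM ?vC // => sm.
have m'F : cone m' \in F by apply/MF; exists m'.
have nsub t : t `<=` cone m' `\ code_ray i -> ~~ (gens (decode n) `<=` t).
  move=> tm; apply/negP => nt.
  have /fsubsetP/(_ (code_ray i)) := fsubset_trans nt tm.
  rewrite gens_decode in_fsetD1 eqxx /= => H.
  by have := H (introT (coneP _ _) (ex_intro2 _ _ i iI erefl)).
(* Whether [s] uses the new ray decides between the two halves of the star subdivision; if it does,
   the old cone below it is [s] without that ray. *)
apply/in_blowup; case: (boolP (r \in s)) => rs; [right|left].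
  exists (s `\ r).
  have srm : s `\ r `<=` cone m' `\ code_ray i by rewrite fsubDset.
  have srm' := fsubset_trans srm (fsubD1set _ _).
  split; [exact: down srm' m'F|exact: nsub| |by rewrite fsetD1K].
  by apply: down m'F; rewrite fsubUset srm' gens_sub_cone ?vM ?nm'.
have {}sm : s `<=` cone m' `\ code_ray i.
  apply/fsubsetP => w ws; have := fsubsetP sm w ws; rewrite in_fset1U => /orP[/eqP wr|//].
  by rewrite -wr ws in rs.
split; last exact: nsub.
by apply: down m'F; apply: fsubset_trans sm (fsubD1set _ _).
Qed.

Lemma P3_spans : spans P3_max P3_fan.
Proof.
move=> s; split=> [/P3_fanP[I I3 ->]|[m mM sm]].
  rewrite -(encodeK I); have : #|decode (encode I)| <= 3 by rewrite encodeK.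
  rewrite card_decode; move: (encode I) (encode_lt I) => n n16 n3.
  suff /hasP[m mM nm] : has (subseteq (vertices n)) P3_max.
    by exists m => //; rewrite gens_decode cone_sub.
  by move: n16 n3; do 16 (case: n => [//|n]).
have mS : exists2 n, m = vertices n & size (vertices n) <= 3.
  by move: mM; rewrite !inE => /or4P[]/eqP ->; [exists 14|exists 13|exists 11|exists 7].
case: mS sm => n -> n3; rewrite -gens_decode => sm.
apply/P3_fanP; exists [set i in decode n | v i \in s]%SET.
  rewrite -card_decode in n3; apply: leq_trans n3; apply/subset_leq_card.
  by apply/subsetP => i; rewrite inE => /andP[].
apply/fsetP => w; apply/idP/imfsetP => [ws|[i /=]]; last first.
  by rewrite inE => /andP[_ ?] ->.
have /imfsetP[i /= ni wi] := fsubsetP sm w ws.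
by exists i => //=; rewrite inE ni -wi.
Qed.

Lemma foldl_blow_codes (C : seq nat) M Q : subseteq Q C ->
  all (fun m => subseteq m C) M -> all (fun m => subseteq m C) (foldl blow M Q).
Proof.
elim: Q M => //= n Q IH M /andP[nC QC] MC; apply: IH => //; exact: blow_codes.
Qed.

Lemma foldl_blow_spans M F Q : subseteq Q codes -> valid M -> spans M F ->
  spans (foldl blow M Q) (foldl blowup F (map decode Q)).
Proof.
elim: Q M F => //= n Q IH M F /andP[nC QC] vM MF.
by apply: IH => //; [apply: blow_codes|apply: blow_spans].
Qed.

Lemma refines_spans M N F : refines M N -> refines N M -> spans M F -> spans N F.
Proof.
have sub A B s : refines A B -> (exists2 m, m \in A & s `<=` cone m) ->
    exists2 m, m \in B & s `<=` cone m.
  move=> /allP AB [m /AB/hasP[m' m'B mm'] sm]; exists m' => //.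
  exact: fsubset_trans sm (cone_sub mm').
by move=> MN NM MF s; rewrite MF; split; apply: sub.
Qed.

End Codes.

(** * Presentation of a blowup by codes, and the rays of its fan *)

Definition coded (X : toric_blowup) (P L : seq nat) : Prop :=
  [/\ P \in sublists point_codes,
      exists2 Ls, Ls \in sublists line_codes & L \in permutations Ls,
      points X = [set I | encode I \in P]%SET & lines X = map decode L].

Section Coding.
Local Open Scope fset_scope.

Lemma filter_sublists a s : filter a s \in sublists s.
Proof.
elim: s => [|x s IH] /=; rewrite ?mem_head // mem_cat.
by case: (a x); rewrite ?IH // map_f ?orbT.
Qed.

Lemma sublists_subseq s t : t \in sublists s -> subseq t s.
Proof.
elim: s t => [|x s IH] t /=; first by rewrite inE => /eqP ->.
rewrite mem_cat => /orP[/IH ts|/mapP[u /IH us ->]].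
  by apply: subseq_trans ts (subseq_cons _ _).
by rewrite /= eqxx.
Qed.

Lemma uniq_filter_perm (s t : seq nat) : uniq s -> uniq t -> {subset s <= t} ->
  perm_eq s [seq x <- t | x \in s].
Proof.
move=> us ut st; apply: uniq_perm => // [|x]; first exact: filter_uniq.
by rewrite mem_filter; case: (boolP (x \in s)) => // /st ->.
Qed.

Lemma map_encodeK s : map decode (map encode s) = s.
Proof. by rewrite -map_comp map_id_in // => I _; apply: encodeK. Qed.

Lemma encode_inj : injective encode.
Proof. exact: can_inj encodeK. Qed.

(** The points are listed in the order of [point_codes]. For the lines, [Ls] is the list in standard
    order, which stands for the set, and [L] keeps the actual order, on which the fan depends. *)
Lemma coded_ex X : exists P L, coded X P L.
Proof.
exists [seq n <- point_codes | decode n \in points X], (map encode (lines X)).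
split; first exact: filter_sublists; last by rewrite map_encodeK.
  have uL : uniq (map encode (lines X)).
    by rewrite (map_inj_uniq encode_inj) (lines_uniq X).
  exists [seq n <- line_codes | n \in map encode (lines X)]; first exact: filter_sublists.
  rewrite mem_permutations; apply: uniq_filter_perm => // n /mapP[I IX ->].
  by rewrite -mem_line_codes (lines_are_lines IX).
apply/setP => I; rewrite inE mem_filter encodeK -mem_point_codes.
by case: (boolP (I \in points X)) => // /points_are_points ->.
Qed.

(* [enum (points X)] may list the points in any order. *)
Lemma point_order : all (fun P => all (fun Q =>
    let M := foldl blow P3_max P in let N := foldl blow P3_max Q in
    refines M N && refines N M) (permutations P)) (sublists point_codes).
Proof. by vm_compute. Qed.

Lemma mem_foldl_blowup (F : fan) l t : t \in F ->
  (forall J, J \in l -> ~~ (gens J `<=` t)) -> t \in foldl blowup F l.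
Proof.
elim: l F => //= J l IH F Ft lt; apply: IH => [|K Kl].
  2: by apply: lt; rewrite inE Kl orbT.
by apply/in_blowup; left; split=> //; apply: lt; rewrite mem_head.
Qed.

Lemma gens_sub_card (J : {set 'I_4}) t : gens J `<=` t -> #|J| <= #|` t|.
Proof.
move=> /fsubset_leq_card; apply: leq_trans.
by rewrite card_imfset -?cardE //; apply: v_inj.
Qed.

(* Until I itself is blown up, its cone survives. *)
Lemma ray_mem_foldl (F : fan) (s : seq {set 'I_4}) (I : {set 'I_4}) :
  (forall J, J \in s -> 1 < #|J|) -> (forall J, J \in s -> J \subset I -> J = I) ->
  uniq s -> I \in s -> fset0 \in F -> gens I \in F -> [fset ray I] \in foldl blowup F s.
Proof.
move=> s2 sI us Is F0 FI.
(* Centers have at least two generators, so the empty cone and the rays survive every blowup. *)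
have small J t : J \in s -> #|` t| <= 1 -> ~~ (gens J `<=` t).
  move=> /s2; rewrite ltnNge => /negP J2 t1; apply/negP => /gens_sub_card Jt.
  by apply: J2; apply: leq_trans t1.
elim: s F us Is s2 sI F0 FI small => //= K s IH F /andP[Ks us].
rewrite inE => Is s2 sI F0 FI small.
case/predU1P: Is => [IK|Is].
  apply: mem_foldl_blowup => [|J Js]; last by apply: small; rewrite ?inE ?Js ?orbT ?cardfs1.
  rewrite -IK; apply/in_blowup; right; exists fset0.
  by rewrite {1}IK; split; rewrite ?fsetU0 // small ?mem_head ?cardfs0.
apply: IH => // [J Js|J Js|||J t Js].
- by apply: s2; rewrite inE Js orbT.
- by apply: sI; rewrite inE Js orbT.
- by apply/in_blowup; left; split; rewrite ?small ?mem_head ?cardfs0.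
- apply/in_blowup; left; split=> //; apply: contraNN Ks => /gens_sub KI.
  rewrite (sI K) ?mem_head //; apply/subsetP => i /KI; by rewrite mem_gens.
- by apply: small; rewrite inE Js orbT.
Qed.

End Coding.

Definition ray_codes (P L : seq nat) : seq nat := singles ++ P ++ L.

Section Coded.
Local Open Scope fset_scope.
Variables (X : toric_blowup) (P L : seq nat).
Hypothesis XPL : coded X P L.

Lemma coded_points : subseteq P point_codes.
Proof. by case: XPL => /sublists_subseq/mem_subseq PC _ _ _; apply/allP. Qed.

Lemma coded_lines : subseteq L line_codes.
Proof.
case: XPL => _ [Ls /sublists_subseq/mem_subseq LC]; rewrite mem_permutations => /perm_mem LLs _ _.
by apply/allP => n; rewrite LLs => /LC.
Qed.

Lemma coded_uniq_lines : uniq L.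
Proof.
have := lines_uniq X; case: XPL => _ _ _ ->; exact: map_uniq.
Qed.

Lemma coded_codes : subseteq (ray_codes P L) codes.
Proof.
apply/allP => n; rewrite !mem_cat => /or3P[|/(allP coded_points)|/(allP coded_lines)];
  exact: (allP (_ : subseteq _ codes)).
Qed.

Lemma coded_mem_points n : n < 16 -> (decode n \in points X) = (n \in P).
Proof. by case: XPL => _ _ -> _ n16; rewrite inE decodeK. Qed.

Lemma coded_enum : exists2 Q, Q \in permutations P & enum (points X) = map decode Q.
Proof.
exists (map encode (enum (points X))); last by rewrite map_encodeK.
rewrite mem_permutations; apply: uniq_perm.
- by rewrite (map_inj_uniq encode_inj) enum_uniq.
- by case: XPL => /sublists_subseq/subseq_uniq PC _ _ _; apply: PC.
case: XPL => _ _ XP _ n; apply/mapP/idP => [[I]|nP].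
  by rewrite mem_enum XP inE => IP ->.
have n16 : n < 16 by have := allP coded_points n nP; rewrite !inE => /or4P[]/eqP->.
by exists (decode n); rewrite ?decodeK // mem_enum coded_mem_points.
Qed.

Lemma coded_spans : spans (max_cones P L) (fan_of X).
Proof.
have [Q QP XQ] := coded_enum; have [PS _ _ XL] := XPL.
have QC : subseteq Q point_codes.
  by apply/allP => n; rewrite mem_permutations in QP; rewrite (perm_mem QP) => /(allP coded_points).
have /allP/(_ _ PS)/allP/(_ _ QP)/andP[PQ QP'] := point_order.
have /andP[PC LC] : subseteq P codes && subseteq L codes.
  by have := coded_codes; rewrite /ray_codes /subseteq !all_cat => /and3P[_ -> ->].
rewrite /fan_of XQ XL; apply: foldl_blow_spans => //; first exact: foldl_blow_codes.
apply: (refines_spans QP' PQ); apply: foldl_blow_spans => //; last exact: P3_spans.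
by apply/allP => n /(allP QC); apply: (allP (_ : subseteq _ codes)).
Qed.

Lemma max_cones_codes : all (fun m => subseteq m (ray_codes P L)) (max_cones P L).
Proof.
apply: foldl_blow_codes; first by apply/allP => n nL; rewrite !mem_cat nL !orbT.
apply: foldl_blow_codes; first by apply/allP => n nP; rewrite !mem_cat nP !orbT.
by apply/allP => m; rewrite !inE => /or4P[]/eqP->; rewrite /= ?mem_cat ?inE.
Qed.

Lemma max_cones_valid : valid (max_cones P L).
Proof.
apply/allP => m /(allP max_cones_codes)/allP mS; apply/allP => n /mS.
exact: (allP coded_codes).
Qed.

Lemma lines_card J : J \in lines X -> #|J| = 2.
Proof. by move/lines_are_lines/eqP. Qed.

Lemma points_card J : J \in points X -> #|J| = 3.
Proof. by move/points_are_points/eqP. Qed.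

Lemma fset0_P3 : fset0 \in P3_fan.
Proof.
apply/P3_fanP; exists set0; rewrite ?cards0 //.
by apply/fsetP => w; rewrite inE; apply/esym/imfsetP => -[i]; rewrite /= inE.
Qed.

Lemma mem_ray_codes n : n \in codes -> ([fset code_ray n] \in fan_of X) = (n \in ray_codes P L).
Proof.
move=> nC; apply/idP/idP => [/coded_spans[m mM]|].
  rewrite fsub1set mem_cone //; last exact: (allP max_cones_valid).
  by apply: (allP (allP max_cones_codes m mM)).
have n16 : n < 16 by rewrite mem_iota in nC; case/andP: nC => _ /ltnW.
rewrite !mem_cat => /or3P[/singlesP[i ->]|nP|nL].
- rewrite code_ray_pow2 -(_ : gens [set i] = [fset v i]).
    apply: gens_fan_of => [|I IX]; first by rewrite cards1.
    apply/negP => /subset_leq_card; rewrite cards1.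
    by case: IX => [/points_card ->|/lines_card ->].
  apply/fsetP => w; rewrite inE; apply/imfsetP/eqP => [[j /= /set1P -> //]|->].
  by exists i; rewrite ?inE.
- have IX : decode n \in points X by rewrite coded_mem_points.
  apply: mem_foldl_blowup => [|J /lines_card J2]; last first.
    by apply/negP => /gens_sub_card; rewrite J2 cardfs1.
  apply: ray_mem_foldl => [J|J||||].
  + by rewrite mem_enum => /points_card ->.
  + rewrite mem_enum => JX JI; apply/eqP; rewrite eqEcard JI.
    by rewrite (points_card IX) (points_card JX).
  + exact: enum_uniq.
  + by rewrite mem_enum.
  + exact: fset0_P3.
  + by apply/P3_fanP; exists (decode n); rewrite ?(points_card IX).
have IX : decode n \in lines X by case: XPL => _ _ _ ->; apply: map_f.
apply: ray_mem_foldl => // [J|J|||].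
+ by move=> /lines_card ->.
+ by move=> /lines_card J2 JI; apply/eqP; rewrite eqEcard JI J2 (lines_card IX).
+ exact: lines_uniq.
+ apply: mem_foldl_blowup => [|J]; first exact: fset0_P3.
  by rewrite mem_enum => /points_card J3; apply/negP => /gens_sub_card; rewrite J3 cardfs0.
apply: mem_foldl_blowup => [|J].
  by apply/P3_fanP; exists (decode n); rewrite ?(lines_card IX).
rewrite mem_enum => /points_card J3; apply/negP => /gens_sub JI.
have /subset_leq_card : J \subset decode n.
  by apply/subsetP => i /JI; rewrite mem_gens.
by rewrite J3 (lines_card IX).
Qed.

End Coded.

(* [code_of_sum s] is 0, which is not a code, if the sum of the vectors coded by s
   is not one of the 14 vectors v_I. *)
Definition code_of_sum (s : seq nat) : nat := head 0 [seq n <- codes | same_sum [:: n] s].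
(* A linear map is given by its values on the 14 vectors: entry n of a table is the
   code of the image of the vector with code n. *)
Definition img (T : seq nat) (n : nat) : nat := nth 0 T n.
Definition table (c : seq nat) : seq nat :=
  [seq code_of_sum [seq nth 0 c i | i <- iota 0 4 & bit n i] | n <- iota 0 16].
Definition frames : seq (seq nat) :=
  flatten [seq flatten [seq flatten [seq
    [seq [:: a; b; c; d] | d <- codes & same_sum [:: a; b; c; d] [::]]
    | c <- codes] | b <- codes] | a <- codes].
Definition invertible (T : seq nat) : bool :=
  all (fun k => has (fun n => img T n == k) codes) singles.
Definition candidates : seq (seq nat) := [seq T <- map table frames | invertible T].

Definition stable (S T : seq nat) : bool := all (fun n => img T n \in S) S.
Definition preserves_max (M : seq (seq nat)) (T : seq nat) : bool :=
  all (fun m => has (fun m' => all (fun n => img T n \in m') m) M) M.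
Definition preserves_types (P L T : seq nat) : bool :=
  [&& stable singles T, stable P T & stable L T].

Definition table_mx (T : seq nat) : 'M[int]_3 :=
  (\matrix_(i < 3) code_ray (img T (2 ^ i.+1)))%R.

Section Tables.
Local Open Scope fset_scope.
Local Open Scope ring_scope.

Lemma framesP c : reflect (exists a b d e, [/\ c = [:: a; b; d; e],
    [&& a \in codes, b \in codes, d \in codes & e \in codes] & same_sum c [::]]) (c \in frames).
Proof.
apply: (iffP flatten_mapP) => [[a aC /flatten_mapP[b bC /flatten_mapP[d dC /mapP[e]]]]|].
  by rewrite mem_filter => /andP[s0 eC] ->; exists a, b, d, e; rewrite aC bC dC eC.
case=> a [b [d [e [-> /and4P[aC bC dC eC] s0]]]].
exists a => //; apply/flatten_mapP; exists b => //; apply/flatten_mapP; exists d => //.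
by apply/mapP; exists e => //; rewrite mem_filter s0.
Qed.

Lemma code_of_sumP s m : m \in codes ->
  reflect (code_ray m = \sum_(k <- s) code_ray k) (code_of_sum s == m).
Proof.
move=> mC; rewrite /code_of_sum.
have in_f n : n \in [seq n <- codes | same_sum [:: n] s] =
    (n \in codes) && (code_ray n == \sum_(k <- s) code_ray k).
  rewrite mem_filter andbC; congr (_ && _).
  by apply/same_sumP/eqP; rewrite big_seq1.
move: (filter _ _) in_f => [|h t] in_f; have mE := in_f m; rewrite mC andTb in mE.
  apply: (iffP eqP) => [m0|/eqP]; last by rewrite -mE.
  by move: mC; rewrite -m0.
have := in_f h; rewrite mem_head => /esym/andP[hC /eqP hE].
by apply: (iffP eqP) => [<- //|mh]; apply: code_ray_inj => //; rewrite hE mh.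
Qed.

Lemma img_table c n : (n < 16)%N ->
  img (table c) n = code_of_sum [seq nth 0%N c i | i <- iota 0 4 & bit n i].
Proof. by move=> n16; rewrite /img (nth_map 0%N) ?size_iota // nth_iota. Qed.

Lemma img_table_pow2 c (i : 'I_4) : c \in frames -> img (table c) (2 ^ i) = nth 0%N c i.
Proof.
case/framesP=> a [b [d [e [-> /and4P[aC bC dC eC] _]]]].
have -> : nth 0%N [:: a; b; d; e] i = code_of_sum [:: nth 0%N [:: a; b; d; e] i].
  apply/esym/eqP/code_of_sumP; last by rewrite big_seq1.
  by case: i => [[|[|[|[|?]]]] ?].
by case: i => [[|[|[|[|?]]]] ?] //=; rewrite img_table.
Qed.

Lemma v_basis (i : 'I_3) : v (lift ord0 i) = delta_mx 0 i.
Proof.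
by apply/rowP => j; rewrite !mxE; case: i j => [[|[|[|?]]] ?] // [[|[|[|?]]] ?].
Qed.

Lemma sum_v : \sum_(i < 4) v i = 0.
Proof.
by apply/rowP => j; rewrite summxE !big_ord_recl big_ord0 !mxE; case: j => [[|[|[|?]]] ?].
Qed.

Lemma mx_eq_on_v (g h : 'M[int]_3) : (forall i, v i *m g = v i *m h) -> g = h.
Proof.
move=> gh; apply/row_matrixP => i; rewrite !rowE -v_basis; exact: gh.
Qed.

Lemma v_table_mx c (i : 'I_4) : c \in frames ->
  v i *m table_mx (table c) = code_ray (nth 0%N c i).
Proof.
move=> cF.
have liftE (j : 'I_3) :
    v (lift ord0 j) *m table_mx (table c) = code_ray (nth 0%N c j.+1).
  rewrite v_basis -rowE; apply/rowP => k; rewrite !mxE.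
  by have := img_table_pow2 (lift ord0 j) cF; rewrite lift0 => ->.
case: (unliftP ord0 i) => [j|] ->; first exact: liftE.
have /eqP := congr1 (mulmx^~ (table_mx (table c))) sum_v.
rewrite mul0mx big_ord_recl mulmxDl mulmx_suml (eq_bigr _ (fun j _ => liftE j)).
rewrite addr_eq0 => /eqP ->; case/framesP: cF => a [b [d [e [-> _ /same_sumP]]]].
rewrite big_nil !big_cons big_nil !big_ord_recl big_ord0 /= => /eqP.
by rewrite addr_eq0 => /eqP.
Qed.

Lemma code_ray_table_mx c n m : c \in frames -> (n < 16)%N -> m \in codes ->
  (code_ray n *m table_mx (table c) == code_ray m) = (img (table c) n == m).
Proof.
move=> cF n16 mC; rewrite img_table //.
suff -> : code_ray n *m table_mx (table c) =
    \sum_(k <- [seq nth 0%N c i | i <- iota 0 4 & bit n i]) code_ray k.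
  by apply/eqP/code_of_sumP.
rewrite big_map big_filter -[iota 0 4]/(index_iota 0 4) big_mkord.
rewrite mulmx_suml; apply: eq_big => [i|i _]; first by rewrite inE.
exact: v_table_mx.
Qed.

Lemma candidatesP T : reflect (exists c, [/\ c \in frames, T = table c & invertible T])
  (T \in candidates).
Proof.
rewrite mem_filter; apply: (iffP andP) => [[TI /mapP[c cF TE]]|[c [cF TE TI]]].
  by exists c.
by split; [exact: TI|rewrite TE; apply: map_f].
Qed.

Lemma table_mxP T n m : T \in candidates -> n \in codes -> m \in codes ->
  reflect (code_ray n *m table_mx T = code_ray m) (img T n == m).
Proof.
move=> TC nC mC.
have H : (code_ray n *m table_mx T == code_ray m) = (img T n == m).
  case/candidatesP: TC => c [cF -> _]; apply: code_ray_table_mx => //.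
  by rewrite mem_iota in nC; case/andP: nC => _ /ltnW.
by rewrite -H; apply: eqP.
Qed.

Lemma table_mx_inj : {in candidates &, injective table_mx}.
Proof.
move=> _ _ /candidatesP[c [cF -> _]] /candidatesP[d [dF -> _]] cd; congr table.
have H (i : 'I_4) : code_ray (nth 0%N c i) = code_ray (nth 0%N d i).
  by rewrite -(v_table_mx i cF) -(v_table_mx i dF) cd.
case/framesP: cF H => a1 [a2 [a3 [a4 [-> /and4P[A1 A2 A3 A4] _]]]].
case/framesP: dF => b1 [b2 [b3 [b4 [-> /and4P[B1 B2 B3 B4] _]]]] H.
rewrite (code_ray_inj A1 B1 (H ord0)) (code_ray_inj A2 B2 (H (lift ord0 ord0))).
rewrite (code_ray_inj A3 B3 (H (lift ord0 (lift ord0 ord0)))).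
by rewrite (code_ray_inj A4 B4 (H ord_max)).
Qed.

Lemma table_mx_unit T : T \in candidates -> table_mx T \in unitmx.
Proof.
move=> TC; have [c [_ _ /allP TI]] := candidatesP _ TC.
have /fin_all_exists[f fP] (i : 'I_3) : exists w : lattice, w *m table_mx T = v (lift ord0 i).
  have kS : (2 ^ (lift ord0 i : 'I_4) \in singles)%N by apply/singlesP; exists (lift ord0 i).
  have kC : (2 ^ (lift ord0 i : 'I_4) \in codes)%N by case: i {kS} => [[|[|[|?]]] ?].
  have /hasP[n nC nE] := TI _ kS; exists (code_ray n).
  by have /table_mxP := nE => -> //; rewrite code_ray_pow2.
have BT : (\matrix_(i < 3) f i) *m table_mx T = 1%:M.
  by apply/row_matrixP => i; rewrite row_mul rowK fP v_basis rowE mulmx1.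
by case/mulmx1_unit: BT.
Qed.

Lemma transport_cone T m : T \in candidates -> subseteq m codes ->
  stable m T -> transport (table_mx T) (cone m) = cone m.
Proof.
move=> TC /allP mC /allP mT.
have gU := table_mx_unit TC; apply/eqP; rewrite eqEfcard card_transport // leqnn andbT.
apply/fsubsetP => _ /imfsetP[_ /= /coneP[n nm ->] ->]; apply/coneP.
exists (img T n); first exact: mT.
by apply/table_mxP; rewrite ?mC ?mT.
Qed.

Lemma preserves_cone T m : T \in candidates -> subseteq m codes ->
  preserves (table_mx T) (cone m) <-> stable m T.
Proof.
move=> TC mC; split=> [gm|]; last exact: transport_cone.
apply/allP => n nm; have nC := allP mC n nm.
have : code_ray n *m table_mx T \in cone m.
  by rewrite -gm; apply: transport_mem; apply/coneP; exists n.
case/coneP => k km /table_mxP kE; have kC := allP mC k km.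
by rewrite (eqP (kE TC nC kC)).
Qed.

Section Symmetries.
Variables (R : realFieldType) (X : toric_blowup) (P L : seq nat).
Hypothesis XPL : coded X P L.

Let M := max_cones P L.
Let S := ray_codes P L.

Lemma symmetry_image g n : toric_symmetry R X g -> n \in S ->
  exists2 m, m \in S & code_ray n *m g = code_ray m.
Proof.
move=> /toric_symmetryE[gU gF] nS; have nC := allP (coded_codes XPL) n nS.
have : transport g [fset code_ray n] \in fan_of X by apply: gF; rewrite (mem_ray_codes XPL).
rewrite transport_set1 => gnF; have [m mM] := iffLR (coded_spans XPL _) gnF.
rewrite fsub1set => /coneP[k km kE]; exists k => //.
by apply: (allP (allP (max_cones_codes P L) m mM)).
Qed.

Lemma symmetry_preimage g n : toric_symmetry R X g -> n \in S ->
  exists2 m, m \in S & code_ray m *m g = code_ray n.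
Proof.
move=> gX nS; have [/toric_symmetryE[gU _] _] := (gX, gX).
pose C := cone S.
have CC : transport g C = C.
  apply/eqP; rewrite eqEfcard card_transport // leqnn andbT.
  apply/fsubsetP => _ /imfsetP[_ /= /coneP[k kS ->] ->].
  by have [m mS ->] := symmetry_image gX kS; apply/coneP; exists m.
have : code_ray n \in transport g C by rewrite CC; apply/coneP; exists n.
by case/imfsetP => _ /= /coneP[m mS ->] ->; exists m.
Qed.

Lemma symmetry_table g : toric_symmetry R X g ->
  exists T, [/\ T \in candidates, stable S T, preserves_max M T & g = table_mx T].
Proof.
move=> gX; have SC k : k \in S -> k \in codes := allP (coded_codes XPL) k.
have vS (i : 'I_4) : (2 ^ i)%N \in S by rewrite mem_cat; apply/orP; left; apply/singlesP; exists i.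
have /fin_all_exists2[f fS fE] (i : 'I_4) : exists2 m, m \in S & v i *m g = code_ray m.
  by have := symmetry_image gX (vS i); rewrite code_ray_pow2.
pose c := [seq f (inord i) | i <- iota 0 4].
have cE (i : 'I_4) : nth 0%N c i = f i.
  by rewrite (nth_map 0%N) ?size_iota // nth_iota // add0n inord_val.
have cF : c \in frames.
  apply/framesP; exists (f (inord 0)), (f (inord 1)), (f (inord 2)), (f (inord 3)).
  split; rewrite ?SC ?fS //; apply/same_sumP; rewrite big_nil.
  transitivity (\sum_(i < 4) v i *m g); last by rewrite -mulmx_suml sum_v mul0mx.
  rewrite /c big_map -[iota 0 4]/(index_iota 0 4) big_mkord.
  by apply: eq_bigr => i _; rewrite inord_val fE.
have gE : g = table_mx (table c).
  by apply: mx_eq_on_v => i; rewrite fE v_table_mx // cE.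
have imgE n m : n \in codes -> m \in codes -> code_ray n *m g = code_ray m ->
    img (table c) n = m.
  move=> nC mC nm; apply/eqP; rewrite -code_ray_table_mx // -?gE ?nm //.
  by rewrite mem_iota in nC; case/andP: nC => _ /ltnW.
exists (table c); split; last exact: gE.
- apply/candidatesP; exists c; split=> //; apply/allP => k ks.
  have kS : k \in S by rewrite mem_cat ks.
  have [n nS nk] := symmetry_preimage gX kS.
  by apply/hasP; exists n; rewrite ?SC // (imgE n k) ?SC.
- apply/allP => n nS; have [m mS nm] := symmetry_image gX nS.
  by rewrite (imgE n m) ?SC.
have vM := max_cones_valid XPL.
apply/allP => m mM; have /allP mC := allP vM m mM.
have mF : cone m \in fan_of X by apply/(coded_spans XPL); exists m.
have [/toric_symmetryE[_ gF] _] := (gX, gX).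
have [m' m'M mm'] := iffLR (coded_spans XPL _) (gF _ mF).
apply/hasP; exists m' => //; apply/allP => n nm; have /allP m'C := allP vM m' m'M.
have : code_ray n *m g \in cone m'.
  by apply: (fsubsetP mm'); apply: transport_mem; apply/coneP; exists n.
by case/coneP => k km nk; rewrite (imgE n k (mC n nm) (m'C k km) nk).
Qed.

Lemma table_symmetry T : T \in candidates -> preserves_max M T ->
  toric_symmetry R X (table_mx T).
Proof.
move=> TC /allP TM; apply/toric_symmetryE; split=> [|s]; first exact: table_mx_unit.
have vM := max_cones_valid XPL.
move=> /(coded_spans XPL)[m mM sm]; have /hasP[m' m'M /allP mm'] := TM m mM.
apply/(coded_spans XPL); exists m' => //; apply: fsubset_trans (transport_sub _ sm) _.
apply/fsubsetP => _ /imfsetP[_ /= /coneP[n nm ->] ->]; apply/coneP.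
exists (img T n); first exact: mm'.
apply/table_mxP => //; first exact: (allP (allP vM m mM)).
by apply: (allP (allP vM m' m'M)); apply: mm'.
Qed.

Lemma point_rays_cone : point_rays X = cone P.
Proof.
apply/fsetP => w; apply/imfsetP/coneP => [[I /= IX ->]|[n nP ->]].
  by exists (encode I); rewrite /code_ray ?encodeK //; case: XPL IX => _ _ -> _; rewrite inE.
exists (decode n) => //=; rewrite (coded_mem_points XPL) //.
have := allP (coded_points XPL) n nP; by rewrite !inE => /or4P[]/eqP->.
Qed.

Lemma line_rays_cone : line_rays X = cone L.
Proof.
case: XPL => _ _ _ XL; apply/fsetP => w; apply/imfsetP/coneP => [[I /=]|[n nL ->]].
  by rewrite XL => /mapP[n nL ->] ->; exists n.
by exists (decode n); rewrite //= XL map_f.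
Qed.

Lemma coordinate_rays_cone : coordinate_rays = cone singles.
Proof.
apply/fsetP => w; apply/imfsetP/coneP => [[i _ ->]|[_ /singlesP[i ->] ->]].
  by exists (2 ^ i)%N; [apply/singlesP; exists i|rewrite code_ray_pow2].
by exists i; rewrite ?code_ray_pow2.
Qed.

Lemma preserves_typesP T : T \in candidates ->
  preserves_ray_types X (table_mx T) <-> preserves_types P L T.
Proof.
move=> TC; rewrite /preserves_ray_types coordinate_rays_cone point_rays_cone line_rays_cone.
have SC := coded_codes XPL.
have sub Q : {subset Q <= S} -> subseteq Q codes.
  by move=> QS; apply/allP => n /QS; apply: (allP SC).
have PC : subseteq P codes by apply: sub => n nP; rewrite !mem_cat nP orbT.
have LC : subseteq L codes by apply: sub => n nL; rewrite !mem_cat nL !orbT.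
split=> [[]|/and3P[]].
  by rewrite !preserves_cone //; move=> *; apply/and3P.
by split; apply/preserves_cone.
Qed.

End Symmetries.
End Tables.

Definition on_code (p l : nat) : bool := all (fun i => bit l i ==> bit p i) (iota 0 4).
Definition meet_code (l m : nat) : bool :=
  has (fun p => on_code p l && on_code p m) point_codes.
Arguments on_code : simpl never.
Arguments meet_code : simpl never.
Definition chainB (p q l1 l2 l3 : nat) : bool :=
  [&& meet_code l1 l2, meet_code l2 l3, ~~ meet_code l1 l3,
      on_code p l1, on_code q l3, ~~ on_code p l2 & ~~ on_code q l2].
Definition chainC (p q l1 l2 l3 : nat) : bool :=
  [&& meet_code l1 l2, meet_code l1 l3, ~~ meet_code l2 l3,
      on_code p l2, on_code q l3, ~~ on_code p l1 & ~~ on_code q l1].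
Definition class_code (k : blowup_class) (P L : seq nat) : bool :=
  match k, P, L with
  | ClassA, [:: p], [:: l1; l2] => [&& meet_code l1 l2, ~~ on_code p l1 & ~~ on_code p l2]
  | ClassB, [:: p; q], [:: l1; l2; l3] => chainB p q l1 l2 l3 || chainB q p l1 l2 l3
  | ClassC, [:: p; q], [:: l1; l2; l3] => chainC p q l1 l2 l3 || chainC q p l1 l2 l3
  | ClassD, _, _ => (size P == 4) && (size L == 6)
  | _, _, _ => false
  end.
Definition unique_class (P L : seq nat) : bool :=
  class_code ClassA P L + class_code ClassB P L +
  class_code ClassC P L + class_code ClassD P L == 1.

(* Conjunctions with an expensive second member are written with [if], as
   [&&] is strict in call-by-value evaluation. *)
Definition indicator (S : seq nat) : seq bool := [seq n \in S | n <- iota 0 16].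
Definition ray_tables (P L : seq nat) : seq (seq nat) :=
  let S := ray_codes P L in let b := indicator S in
  [seq T <- candidates |
    if all (fun n => nth false b (img T n)) S then ~~ preserves_types P L T else false].
Definition nontrivial_tables (cs : seq (seq nat)) (P L : seq nat) : seq (seq nat) :=
  if cs is [::] then [::] else let M := max_cones P L in filter (preserves_max M) cs.
Definition unique_table (P L : seq nat) (cs : seq (seq nat)) : bool :=
  has (fun T0 => all (fun T => has (fun r =>
    if all (fun k => img r (img T0 k) == img T k) singles
    then preserves_types P L r && preserves_max (max_cones P L) r else false)
    candidates) cs) cs.
Definition verdict (P L : seq nat) (cs : seq (seq nat)) : bool :=
  [&& unique_class P L == (cs != [::]),
      if class_code ClassA P L || class_code ClassB P L then unique_table P L cs
      else true
    & class_code ClassC P L ==> uniq cs && (size cs == 4)].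
(* Once all points are blown up, the lines are disjoint, so their order only
   permutes the blocks of maximal cones around each of them. *)
Definition block (M : seq (seq nat)) (l : nat) : seq (seq nat) :=
  [seq m <- M | head 0 m == l].
Definition census : bool :=
  let N := max_cones point_codes line_codes in
  all (fun P => all (fun Ls => let cs := ray_tables P Ls in all (fun L =>
      if class_code ClassD P L then
        unique_class P L && (max_cones P L == flatten [seq block N l | l <- L])
      else verdict P L (nontrivial_tables cs P L))
    (permutations Ls)) (sublists line_codes)) (sublists point_codes).

Lemma census_true : census.
Proof. by vm_compute. Qed.

Lemma unique_table_D :
  let cs := nontrivial_tables (ray_tables point_codes line_codes) point_codes line_codes in
  (cs != [::]) && unique_table point_codes line_codes cs.
Proof. by vm_compute. Qed.

(* Keeps [done] from evaluating them. *)
Opaque candidates max_cones.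

Section Main.
Local Open Scope fset_scope.

Lemma codes_lt n : n \in codes -> n < 16.
Proof. by rewrite mem_iota => /andP[_ /ltnW]. Qed.

Lemma nth_indicator S n : subseteq S codes -> nth false (indicator S) n = (n \in S).
Proof.
move=> /allP SC; have [n16|n16] := ltnP n 16.
  by rewrite (nth_map 0) ?size_iota // nth_iota.
rewrite nth_default ?size_map ?size_iota //; apply/esym/negP => /SC/codes_lt.
by rewrite ltnNge n16.
Qed.

Lemma mem_nontrivial_tables P Ls L T : subseteq (ray_codes P Ls) codes -> L =i Ls ->
  T \in nontrivial_tables (ray_tables P Ls) P L =
  [&& T \in candidates, stable (ray_codes P L) T, ~~ preserves_types P L T
    & preserves_max (max_cones P L) T].
Proof.
move=> SC LLs.
have -> : T \in nontrivial_tables (ray_tables P Ls) P L =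
    (T \in ray_tables P Ls) && preserves_max (max_cones P L) T.
  rewrite /nontrivial_tables; case: (ray_tables P Ls) => [|t ts]; first by rewrite !in_nil.
  by rewrite mem_filter andbC.
have stableE Q Q' : Q =i Q' -> stable Q T = stable Q' T.
  by move=> QQ; rewrite /stable (eq_all_r QQ); apply: eq_all => n; rewrite QQ.
have indE : all (fun n => nth false (indicator (ray_codes P Ls)) (img T n)) (ray_codes P Ls)
    = stable (ray_codes P L) T.
  rewrite (stableE _ (ray_codes P Ls)); last by move=> n; rewrite !mem_cat LLs.
  by apply: eq_all => n; rewrite nth_indicator.
rewrite /ray_tables; move: candidates => ?.
rewrite mem_filter -[if _ then _ else false]/(_ && _) indE /preserves_types (stableE _ _ LLs).
by rewrite [_ && (T \in _)]andbC -!andbA.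
Qed.

Lemma on_codeE p l : on (decode p) (decode l) = on_code p l.
Proof.
apply/subsetP/allP => [pl i|pl i].
  rewrite mem_iota => /= i4; apply/implyP => li.
  by have := pl (Ordinal i4); rewrite !inE; apply.
rewrite !inE => li; have := pl (i : nat); rewrite mem_iota ltn_ord.
by move=> /(_ isT)/implyP; apply.
Qed.

Lemma meet_codeE l m : meet (decode l) (decode m) = meet_code l m.
Proof.
apply/existsP/hasP => [[p /and3P[pP pl pm]]|[p pP /andP[pl pm]]].
  exists (encode p); first by rewrite -mem_point_codes.
  by rewrite -!on_codeE encodeK pl.
exists (decode p); rewrite !on_codeE pl pm mem_point_codes decodeK ?pP //.
by move: pP; rewrite !inE => /or4P[]/eqP->.
Qed.

Section OneBlowup.
Variables (X : toric_blowup) (P L : seq nat).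
Hypothesis XPL : coded X P L.

Lemma lines_codedP ls : lines X = ls <-> L = map encode ls.
Proof.
case: XPL => _ _ _ ->; split=> [<-|->]; last exact: map_encodeK.
rewrite -map_comp map_id_in // => n nL /=; rewrite decodeK //.
have := allP (coded_lines XPL) n nL.
by rewrite !inE => /or4P[|||/or3P[]]/eqP->.
Qed.

Lemma mem_P I : (encode I \in P) = (I \in points X).
Proof. by case: XPL => _ _ -> _; rewrite inE. Qed.

Lemma uniq_P : uniq P.
Proof. by case: XPL => /sublists_subseq/subseq_uniq PC _ _ _; apply: PC. Qed.

Lemma P_decodeK n : n \in P -> encode (decode n) = n.
Proof. by move=> /(allP (coded_points XPL)); rewrite !inE => /or4P[]/eqP->; rewrite decodeK. Qed.

Lemma points1 p : points X = [set p]%SET <-> P = [:: encode p].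
Proof.
split=> [Xp|Pp]; last by apply/setP => I; rewrite -mem_P Pp !inE (inj_eq encode_inj).
apply: perm_small_eq => //; apply: uniq_perm => // [|n]; first exact: uniq_P.
rewrite inE; apply/idP/eqP => [nP|->]; last by rewrite mem_P Xp set11.
by have := nP; rewrite -(P_decodeK nP) mem_P Xp inE => /eqP ->.
Qed.

Lemma points2 p q : p != q -> points X = [set p; q]%SET <->
  P = [:: encode p; encode q] \/ P = [:: encode q; encode p].
Proof.
move=> pq; have epq : encode p != encode q by rewrite (inj_eq encode_inj).
split=> [Xp|Pp]; last first.
  apply/setP => I; rewrite -mem_P.
  by case: Pp => ->; rewrite !inE !(inj_eq encode_inj) // orbC.
have : perm_eq P [:: encode p; encode q].
  apply: uniq_perm => // [||n]; [exact: uniq_P|by rewrite /= inE epq|].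
  rewrite !inE; apply/idP/orP => [nP|[]/eqP->]; last 2 first.
  - by rewrite mem_P Xp !inE eqxx.
  - by rewrite mem_P Xp !inE eqxx orbT.
  have := nP; rewrite -(P_decodeK nP) mem_P Xp !inE.
  by case/orP => /eqP ->; rewrite eqxx; [left|right].
case: P => [|a [|b [|c s]]] ab; have := perm_size ab => //= _.
have := perm_mem ab; have := perm_uniq ab; rewrite /= !inE epq andbT => anb H.
have := H a; have := H b; rewrite !inE !eqxx orbT /=.
move=> /esym/orP[]/eqP bE /esym/orP[]/eqP aE; move: anb; rewrite aE bE ?eqxx //; by [left|right].
Qed.

Lemma class_pairP
    (Q : {set 'I_4} -> {set 'I_4} -> {set 'I_4} -> {set 'I_4} -> {set 'I_4} -> Prop)
    (q : nat -> nat -> nat -> nat -> nat -> bool) :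
  (forall a b l m n, Q (decode a) (decode b) (decode l) (decode m) (decode n) <-> q a b l m n) ->
  (exists p1 p2 l1 l2 l3, [/\ p1 != p2, points X = [set p1; p2]%SET,
    lines X = [:: l1; l2; l3] & Q p1 p2 l1 l2 l3]) <->
  is_true (if (P, L) is ([:: a; b], [:: l; m; n]) then q a b l m n || q b a l m n else false).
Proof.
move=> Qq; split=> [[p1 [p2 [l1 [l2 [l3 [p12 /(points2 p12) XP /lines_codedP -> QX]]]]]]|].
  have {}QX : q (encode p1) (encode p2) (encode l1) (encode l2) (encode l3).
    by apply/Qq; rewrite !encodeK.
  by case: XP => ->; rewrite /= QX ?orbT.
case: P XPL uniq_P P_decodeK mem_P (fun p q : {set 'I_4} => @points2 p q)
  => [|a [|b [|? ?]]] // XabL; rewrite [uniq _]/= ?inE ?andbT => ab PK _ pts2.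
case: L XabL => [|l [|m [|n [|? ?]]]] // [_ _ _ /= XL].
have aK : encode (decode a) = a by rewrite PK ?mem_head.
have bK : encode (decode b) = b by rewrite PK // !inE eqxx orbT.
have dab : decode a != decode b by apply: contra ab => /eqP e; rewrite -aK e bK.
case/orP => qX.
  exists (decode a), (decode b), (decode l), (decode m), (decode n); split=> //; last exact/Qq.
  by apply/pts2; rewrite // aK bK; left.
exists (decode b), (decode a), (decode l), (decode m), (decode n); rewrite eq_sym.
split=> //; last exact/Qq.
by rewrite setUC; apply/pts2; rewrite // aK bK; left.
Qed.

Lemma in_classP k : in_class k X <-> class_code k P L.
Proof.
case: k; rewrite /in_class /in_classA /in_classB /in_classC /in_classD /class_code.
- split=> [[p [l1 [l2 [/points1 -> /lines_codedP ->]]]]|].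
    by rewrite /= -!meet_codeE -!on_codeE !encodeK => -> -> ->.
  case: P XPL P_decodeK points1 => [|a [|? ?]] // XaL PK pts1.
  case: L XaL => [|l [|m [|? ?]]] // [_ _ _ /= XL].
  rewrite /= -!meet_codeE -!on_codeE => /and3P[? ? ?].
  exists (decode a), (decode l), (decode m); split=> //.
  by apply/pts1; rewrite PK ?mem_head.
- apply: iff_trans (class_pairP (Q := fun p1 p2 l1 l2 l3 =>
    [/\ meet l1 l2, meet l2 l3 & ~~ meet l1 l3] /\
    [/\ on p1 l1, on p2 l3, ~~ on p1 l2 & ~~ on p2 l2]) _) => [|a b l m n].
    by split=> -[p1 [p2 [l1 [l2 [l3 H]]]]]; exists p1, p2, l1, l2, l3; case: H => // ? ? ? [].
  rewrite /chainB -!meet_codeE -!on_codeE.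
  split=> [[[-> -> ->] [-> -> -> ->]] //|]; by do 6 case/andP=> ?; move=> ?; split.
- apply: iff_trans (class_pairP (Q := fun p1 p2 l1 l2 l3 =>
    [/\ meet l1 l2, meet l1 l3 & ~~ meet l2 l3] /\
    [/\ on p1 l2, on p2 l3, ~~ on p1 l1 & ~~ on p2 l1]) _) => [|a b l m n].
    by split=> -[p1 [p2 [l1 [l2 [l3 H]]]]]; exists p1, p2, l1, l2, l3; case: H => // ? ? ? [].
  rewrite /chainC -!meet_codeE -!on_codeE.
  split=> [[[-> -> ->] [-> -> -> ->]] //|]; by do 6 case/andP=> ?; move=> ?; split.
have /allP PC := coded_points XPL; have /allP LC := coded_lines XPL.
have uL := coded_uniq_lines XPL.
have mem_L l : (l \in lines X) = (encode l \in L).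
  have -> : L = map encode (lines X) by apply/lines_codedP.
  by rewrite mem_map //; apply: encode_inj.
split=> [[allP_ allL]|/andP[/eqP P4 /eqP L6]].
  apply/andP; split; rewrite eqn_leq.
    rewrite (uniq_leq_size uniq_P PC) (uniq_leq_size (s1 := point_codes)) // => n nP.
    have n16 : n < 16 by move: nP; rewrite !inE => /or4P[]/eqP->.
    by rewrite -(decodeK n16) mem_P allP_ // mem_point_codes decodeK.
  rewrite (uniq_leq_size uL LC) (uniq_leq_size (s1 := line_codes)) // => n nL.
  have n16 : n < 16 by move: nL; rewrite !inE => /or4P[|||/or3P[]]/eqP->.
  by rewrite -(decodeK n16) -mem_L allL // mem_line_codes decodeK.
have [|_ PE] := uniq_min_size uniq_P PC; first by rewrite P4.
have [|_ LE] := uniq_min_size uL LC; first by rewrite L6.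
split=> [p|l]; first by rewrite mem_point_codes -PE mem_P.
by rewrite mem_line_codes -LE mem_L.
Qed.

Definition nontrivial_table (T : seq nat) : bool :=
  [&& T \in candidates, stable (ray_codes P L) T, ~~ preserves_types P L T
    & preserves_max (max_cones P L) T].

Lemma nontrivial_symmetryP (R : realFieldType) g : nontrivial_symmetry R X g <->
  exists2 T, nontrivial_table T & g = table_mx T.
Proof.
split=> [[/(symmetry_table XPL)[T [TC TS TM ->]] nt]|[T /and4P[TC TS nt TM] ->]].
  exists T => //; apply/and4P; split=> //.
  by apply: contra_notN nt => /(preserves_typesP XPL TC).
split; first exact: (table_symmetry R XPL).
by move=> /(preserves_typesP XPL TC); apply/negP.
Qed.

Lemma unique_tableP (R : realFieldType) cs : cs =i nontrivial_table ->
  unique_table P L cs -> unique_up_to_relabeling R X.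
Proof.
move=> csE /hasP[T0 T0cs /allP uT]; have T0n : nontrivial_table T0 by rewrite -[_ T0]csE.
exists (table_mx T0); first by apply/nontrivial_symmetryP; exists T0.
move=> h /nontrivial_symmetryP[T Tn ->]; have /uT/hasP[r rC] : T \in cs by rewrite csE.
case: ifP => // /allP T0r /andP[rt rM].
exists (table_mx r); first by split; [exact: (table_symmetry R XPL)|apply/(preserves_typesP XPL)].
apply: mx_eq_on_v => i; have iS : 2 ^ i \in singles by apply/singlesP; exists i.
have SC k : k \in singles -> k \in codes by apply: (allP (_ : subseteq singles codes)).
have vP T' : nontrivial_table T' ->
    (v i *m table_mx T')%R = code_ray (img T' (2 ^ i)) /\ img T' (2 ^ i) \in codes.
  case/and4P => T'C /allP T'S _ _.
  have iC : img T' (2 ^ i) \in codes.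
    by apply: (allP (coded_codes XPL)); apply: T'S; rewrite mem_cat iS.
  by rewrite -code_ray_pow2; split=> //; apply/(table_mxP T'C (SC _ iS) iC).
have [vT TC] := vP _ Tn; have [vT0 T0C] := vP _ T0n.
by rewrite mulmxA vT vT0; apply/esym/(table_mxP rC T0C TC)/T0r.
Qed.

End OneBlowup.

Lemma exists_unique_classP (c : blowup_class -> bool) :
  (exists! k, c k) <->
  (c ClassA + c ClassB + c ClassC + c ClassD == 1)%N.
Proof.
split=> [[k [ck uk]]|].
  have no k' : k <> k' -> c k' = false by move=> kk'; apply/negP => /uk.
  by case: k ck {uk} no => -> no; rewrite !no.
case EA: (c ClassA); case EB: (c ClassB); case EC: (c ClassC); case ED: (c ClassD) => // _.
- by exists ClassA; split=> // -[]; rewrite ?EB ?EC ?ED.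
- by exists ClassB; split=> // -[]; rewrite ?EA ?EC ?ED.
- by exists ClassC; split=> // -[]; rewrite ?EA ?EB ?ED.
- by exists ClassD; split=> // -[]; rewrite ?EA ?EB ?EC.
Qed.

Lemma exists_unique_class X P L : coded X P L ->
  (exists! k, in_class k X) <-> unique_class P L.
Proof.
move=> XPL; rewrite /unique_class -(exists_unique_classP (fun k => class_code k P L)).
by split=> -[k [/(in_classP XPL) kX uk]]; exists k; split=> // k' /(in_classP XPL); apply: uk.
Qed.

Lemma sublist_full (s t : seq nat) : t \in sublists s -> size t = size s -> t = s.
Proof. by move=> /sublists_subseq ts st; apply/eqP; rewrite -(size_subseq_leqif ts) st. Qed.

Lemma censusP P Ls L : P \in sublists point_codes -> Ls \in sublists line_codes ->
  L \in permutations Ls ->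
  if class_code ClassD P L then
    unique_class P L && (max_cones P L ==
      flatten [seq block (max_cones point_codes line_codes) l | l <- L])
  else verdict P L (nontrivial_tables (ray_tables P Ls) P L).
Proof.
by move=> PS LS LL; have /allP/(_ _ PS)/allP/(_ _ LS)/allP/(_ _ LL) := census_true.
Qed.

Lemma class_D_cones L : L \in permutations line_codes ->
  unique_class point_codes L /\ max_cones point_codes L =i max_cones point_codes line_codes.
Proof.
have PS : point_codes \in sublists point_codes by [].
have LS : line_codes \in sublists line_codes by [].
have censusD L' : L' \in permutations line_codes -> unique_class point_codes L' &&
    (max_cones point_codes L' ==
      flatten [seq block (max_cones point_codes line_codes) l | l <- L']).
  move=> L'L; have := censusP PS LS L'L.
  by rewrite mem_permutations in L'L; rewrite /class_code (perm_size L'L).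
move=> LL; have /andP[uL /eqP ->] := censusD L LL; split=> // m.
have LL0 : line_codes \in permutations line_codes by rewrite mem_permutations.
have /andP[_ /eqP E] := censusD _ LL0; rewrite [in RHS]E.
rewrite mem_permutations in LL.
by apply: perm_mem; apply/perm_flatten/perm_map.
Qed.

Lemma tables_D : exists cs : seq (seq nat), [/\ cs =i nontrivial_table point_codes line_codes,
  cs != [::] & unique_table point_codes line_codes cs].
Proof.
have SC : subseteq (ray_codes point_codes line_codes) codes by [].
have /andP[cs0 csU] := unique_table_D.
exists (nontrivial_tables (ray_tables point_codes line_codes) point_codes line_codes).
by split; [move=> T; exact: (mem_nontrivial_tables _ SC (fun=> erefl))|exact: cs0|exact: csU].
Qed.

Lemma tables_of X P L : coded X P L -> exists2 cs, cs =i nontrivial_table P L &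
  (~~ class_code ClassD P L /\ verdict P L cs) \/
  (class_code ClassD P L /\ [&& unique_class P L, cs != [::] & unique_table P L cs]).
Proof.
move=> XPL; have [PS [Ls LsS LLs] XP XL] := XPL.
have SC : subseteq (ray_codes P Ls) codes.
  apply/allP => n; have := allP (coded_codes XPL) n; rewrite !mem_cat => H nS; apply: H.
  by move: LLs nS; rewrite mem_permutations => /perm_mem ->.
have LLs' : L =i Ls by move: LLs; rewrite mem_permutations => /perm_mem.
have := censusP PS LsS LLs.
case: ifP => [D _|/negbT nD vd]; last first.
  exists (nontrivial_tables (ray_tables P Ls) P L); last by left.
  by move=> T; rewrite (mem_nontrivial_tables _ SC LLs').
have /andP[/eqP P4 /eqP L6] := D.
have PE : P = point_codes by apply: sublist_full.
have LsE : Ls = line_codes.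
  by apply: sublist_full => //; move: LLs; rewrite mem_permutations => /perm_size <-.
move: LLs LLs'; rewrite {}LsE {Ls LsS SC} => LL LL'.
have [uL ME] := class_D_cones LL.
have stableE Q Q' T : Q =i Q' -> stable Q T = stable Q' T.
  by move=> QQ; rewrite /stable (eq_all_r QQ); apply: eq_all => n; rewrite QQ.
have pmE T : preserves_max (max_cones P L) T =
    preserves_max (max_cones point_codes line_codes) T.
  rewrite PE /preserves_max (eq_all_r ME); apply: eq_all => m; exact: eq_has_r ME _.
have ptE T : preserves_types P L T = preserves_types point_codes line_codes T.
  by rewrite PE /preserves_types (stableE _ _ _ LL').
have [cs [csE cs0 csU]] := tables_D; exists cs.
  move=> T; rewrite csE -[LHS]/(nontrivial_table _ _ T) -[RHS]/(nontrivial_table _ _ T).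
  rewrite /nontrivial_table pmE ptE; congr [&& _, _, _ & _].
  by apply: stableE => n; rewrite PE !mem_cat LL'.
right; split=> //; rewrite cs0 PE uL /=; move: csU; rewrite /unique_table.
apply: sub_has => T0; apply: sub_all => T; apply: sub_has => r.
by case: ifP => // _ /andP[rt rM]; rewrite -PE pmE ptE rt.
Qed.

Lemma blowup_of_codes P L : P \in sublists point_codes -> subseteq L line_codes ->
  uniq L -> exists X, coded X P L.
Proof.
move=> PS /allP LC uL; have /mem_subseq PC := sublists_subseq PS.
have lt16 n : n \in line_codes -> n < 16 by rewrite !inE => /or4P[|||/or3P[]]/eqP->.
have pP p : p \in [set I | encode I \in P]%SET -> is_point p.
  by rewrite inE mem_point_codes => /PC.
have lP l : l \in map decode L -> is_line l.
  by case/mapP => n /LC nL ->; rewrite mem_line_codes decodeK // lt16.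
have uD : uniq (map decode L).
  rewrite map_inj_in_uniq // => n m /LC/lt16 n16 /LC/lt16 m16 /(congr1 encode).
  by rewrite !decodeK.
exists (ToricBlowup pP lP uD); split=> //.
exists [seq n <- line_codes | n \in L]; first exact: filter_sublists.
by rewrite mem_permutations; apply: uniq_filter_perm.
Qed.

End Main.

Theorem theorem1 (R : realFieldType) :
  [/\ forall X : toric_blowup,
        (exists g, nontrivial_symmetry R X g) <-> (exists! k, in_class k X),
      forall k : blowup_class, exists X : toric_blowup, in_class k X,
      forall X : toric_blowup,
        in_class ClassA X \/ in_class ClassB X \/ in_class ClassD X ->
        unique_up_to_relabeling R X
    & forall X : toric_blowup, in_class ClassC X ->
        exists s : seq 'M[int]_3,
          [/\ uniq s, size s = 4 & forall g, g \in s <-> nontrivial_symmetry R X g]].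
Proof.
split=> [X|k|X XABD|X XC].
- have [P [L XPL]] := coded_ex X; rewrite (exists_unique_class XPL).
  have [cs csE csV] := tables_of XPL.
  have -> : (exists g, nontrivial_symmetry R X g) <-> cs != [::].
    split=> [[g /(nontrivial_symmetryP XPL)[T]]|].
      by rewrite -[_ T]csE; case: cs {csE csV}.
    case: cs csE {csV} => // T cs csE _; exists (table_mx T).
    by apply/(nontrivial_symmetryP XPL); exists T => //; rewrite -[_ T]csE mem_head.
  by case: csV => [[_ /and3P[/eqP -> _ _]] //|[_ /and3P[-> -> _]]].
- have [P [L [PS LS uL kPL]]] : exists P L, [/\ P \in sublists point_codes,
      subseteq L line_codes, uniq L & class_code k P L].
    by case: k; [exists [:: 14], [:: 3; 5]|exists [:: 11; 14], [:: 3; 5; 12]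
                |exists [:: 11; 14], [:: 5; 3; 12]|exists point_codes, line_codes].
  have [X XPL] := blowup_of_codes PS LS uL; exists X; exact/(in_classP XPL).
- have [P [L XPL]] := coded_ex X; have [cs csE csV] := tables_of XPL.
  apply: (unique_tableP XPL R csE).
  case: csV => [[nD /and3P[_ uAB _]]|[_ /and3P[] //]].
  case: XABD => [|[]] /(in_classP XPL) kPL; last by case/negP: nD.
    by rewrite kPL in uAB.
  by rewrite kPL orbT in uAB.
have [P [L XPL]] := coded_ex X; have [cs csE csV] := tables_of XPL.
move/(in_classP XPL): XC => CPL.
case: csV => [[_ /and3P[_ _]]|[D /and3P[]]]; last first.
  by rewrite /unique_class CPL D -[nat_of_bool true]/1 !addn1.
rewrite CPL => /andP[ucs /eqP cs4]; exists (map table_mx cs); split.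
- rewrite map_inj_in_uniq // => T U; rewrite !csE => /and4P[TC _ _ _] /and4P[UC _ _ _].
  exact: table_mx_inj.
- by rewrite size_map.
move=> g; rewrite (nontrivial_symmetryP XPL); split=> [/mapP|] [T Tcs ->].
  by exists T; rewrite // -[_ T]csE.
by apply: map_f; rewrite csE.
Qed.
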